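(* Let $G\rightrightarrows G_0$ be a Lie groupoid with Lie algebroid $A$, let $\pi:P\to M$ be a principal $G$-bundle with moment map $\epsilon:P\to G_0$, let $H\subset TP$ be a principal connection on $P$ with connection 1-form $\alpha\in\Omega^1(P,\epsilon^*A)$ and curvature $\Omega\in\Omega^2(P,\epsilon^*A)$, and let $\sigma:M\to P$ be a smooth section of $\pi$. Let $\gamma\in C^\infty(M,\mathscr{B}(G))$ be a smooth map from $M$ to the (local) bisections of $G$, and let $\sigma_\gamma:=\sigma\cdot\gamma$ be the section $m\mapsto\sigma(m)\cdot\gamma(m)\big(\epsilon(\sigma(m))\big)$. Put $\theta_\sigma=\sigma^*\alpha$, $\theta_{\sigma_\gamma}=\sigma_\gamma^*\alpha$, $\Omega_\sigma=\sigma^*\Omega$, $\Omega_{\sigma_\gamma}=\sigma_\gamma^*\Omega$. Then $$\theta_{\sigma_\gamma}=\operatorname{Ad}_{\gamma^{-1}}\theta_\sigma+\gamma^{-1}\gamma',\qquad \Omega_{\sigma_\gamma}=\operatorname{Ad}_{\gamma^{-1}}\Omega_\sigma .$$ Here, with $\epsilon_\sigma=\epsilon\circ\sigma$, for all $m\in M$ and $X_m,Y_m\in T_mM$, and any smooth path $\tau\mapsto x(\tau)$ in $M$ with $x(0)=m$, $\dot x(0)=X_m$, the terms mean: $$(\operatorname{Ad}_{\gamma^{-1}}\theta_\sigma)(X_m)=\operatorname{Ad}_{\gamma(m)^{-1}}\big(\theta_\sigma(X_m)\big),\qquad (\operatorname{Ad}_{\gamma^{-1}}\Omega_\sigma)(X_m,Y_m)=\operatorname{Ad}_{\gamma(m)^{-1}}\big(\Omega_\sigma(X_m,Y_m)\big),$$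 $$(\gamma^{-1}\gamma')(X_m)=\frac{d}{d\tau}\Big|_{0}\Big(\gamma(m)(\epsilon_\sigma(m))\Big)^{-1}\cdot\gamma(x(\tau))(\epsilon_\sigma(m)),$$ all of these lying in the fibre of $A$ over the point $t\big(\gamma(m)(\epsilon_\sigma(m))\big)\in G_0$.
   Context: Groupoid conventions: $s,t:G\to G_0$ are source and target, $1:G_0\to G$ the unit map; the product $gh$ is defined when $t(g)=s(h)$, and then $s(gh)=s(g)$, $t(gh)=t(h)$. The Lie algebroid $A$ of $G$ has fibre $A_x=\ker(s_* )_{1_x}$ and anchor $\rho=t_*$; sections of $A$ correspond to left-invariant vector fields on $G$ tangent to the $s$-fibres, which gives the bracket. A (local) bisection of $G$ is a smooth map $\gamma:U\to G$, $U\subset G_0$ open, with $s\circ\gamma=\mathrm{id}_U$ and $t\circ\gamma$ a diffeomorphism onto an open subset of $G_0$. $\operatorname{Ad}_{\gamma^{-1}}$ is the isomorphism of Lie algebroids (over the base map $t\circ\gamma$) obtained by differentiating at units the conjugation $g\mapsto\gamma(s(g))^{-1}\,g\,\gamma(t(g))$; it maps $A_x$ to $A_{t(\gamma(x))}$. A smooth map $M\to\mathscr{B}(G)$ assigns to each $m\in M$ a (local) bisection $\gamma(m)$ such that $(m,x)\mapsto\gamma(m)(x)$ is smooth on its (open) domain; when the bisections are only local, this domain is assumed to contain all points $(m,\epsilon_\sigma(m))$. A right action of $G$ on a manifold $P$ along $\epsilon:P\to G_0$ is a smooth map $\mu:P\,{}_\epsilon\!\times_s G=\{(p,g):\epsilon(p)=s(g)\}\to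 P$, $(p,g)\mapsto pg$, with $\epsilon(pg)=t(g)$, $p\cdot1_{\epsilon(p)}=p$, $p(gh)=(pg)h$. A principal $G$-bundle is a smooth fibre bundle $\pi:P\to M$ with such an action preserving the fibres of $\pi$ and such that $P\,{}_\epsilon\!\times_s G\to P\times_M P$, $(p,g)\mapsto(p,pg)$, is a diffeomorphism. The division map $\delta:P\times_M P\to G$ is defined by $p\cdot\delta(p,q)=q$; put $\delta_p=\delta(p,\cdot):P_{\pi(p)}\to s^{-1}(\epsilon(p))$, a diffeomorphism. A horizontal distribution is a subbundle $H\subset TP$ with $TP=\ker\pi_*\oplus H$; $\mathrm{Ver}$ and $\mathrm{Hor}$ denote the projections onto $\ker\pi_*$ and $H$. Its connection 1-form $\alpha\in\Omega^1(P,\epsilon^*A)$ is $\alpha(X_p)=(\delta_p)_{*,p}\mathrm{Ver}(X_p)\in A_{\epsilon(p)}$. $H$ satisfies the Moerdijk–Mrčun condition if $\epsilon_*H=0$; then for $v\in H_p$ and $g$ with $s(g)=\epsilon(p)$ one defines $(R_g)_*v=\mu_*(v,0_g)$. $H$ is a principal connection if it satisfies the Moerdijk–Mrčun condition and $H_{pg}=(R_g)_*H_p$ for all $(p,g)\in P\,{}_\epsilon\!\times_s G$. The curvature $\Omega\in\Omega^2(P,\epsilon^*A)$ is the Ehresmann curvature $\omega(u,v)=-\mathrm{Ver}\big([\mathrm{Hor}(\tilde u),\mathrm{Hor}(\tilde v)]\big)_p$ (for $u,v\in T_pP$ with arbitrary vector field extensions $\tilde u,\tilde v$), composed with the identification $(\delta_p)_{*,p}:\ker(\pi_*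 )_p\cong A_{\epsilon(p)}$. *)

(* Defs.v *)
From HB Require Import structures.
From mathcomp Require Import all_boot all_order all_algebra.
From mathcomp Require Import all_classical all_reals all_analysis.

Set Implicit Arguments.
Unset Strict Implicit.
Unset Printing Implicit Defensive.

Import Order.TTheory GRing.Theory Num.Theory numFieldNormedType.Exports.

Local Open Scope classical_set_scope.
Local Open Scope ring_scope.

Section smooth_normed.
Context {R : realType}.
Implicit Types V W : normedModType R.

(* Only meaningful for U open. *)
Fixpoint Ck V W (k : nat) (U : set V) (f : V -> W) : Prop :=
  match k with
  | 0 => forall x, U x -> {for x, continuous f}
  | k'.+1 => (forall x, U x -> differentiable f x) /\
             (forall v, Ck k' U (fun x => 'D_v f x))
  end.

Definition Cinfty V W (U : set V) (f : V -> W) : Prop := forall k, Ck k U f.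

Lemma near_eq_differentiable V W (f g : V -> W) (x : V) :
  (\near x, f x = g x) -> differentiable f x -> differentiable g x.
Proof.
move=> fg df; rewrite -[g](subrK f).
apply: differentiableD => //.
have kx : (g - f) x = 0.
  by rewrite -[LHS]/(g x - f x) (nbhs_singleton fg : f x = g x) subrr.
have E : (g - f) \o shift x = cst ((g - f) x) + (\0 : V -> W) +o_ 0 id.
  rewrite kx; apply/eqaddoP => _/posnumP[e]; near=> y.
  have fgy : f (y + x) = g (y + x).
    near: y; move: fg; rewrite (near_shift 0 x) /=; apply: filterS => y /=.
    by rewrite subr0 addrC.
  rewrite -[X in `|X|]/(g (y + x) - f (y + x) - (0 + 0)) fgy addr0 subr0 subrr.
  by rewrite normr0 mulr_ge0.
have c0 : continuous (\0 : V -> W) by move=> y; exact: cvg_cst.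
have D : 'd (g - f) x = \0 :> (V -> W) by exact: diff_unique c0 E.
by apply/diff_locallyP; rewrite D.
Unshelve. all: by end_near. Qed.

Lemma Ck_ext V W k (U : set V) (f g : V -> W) : open U ->
  (forall x, U x -> f x = g x) -> Ck k U f -> Ck k U g.
Proof.
move=> oU; elim: k f g => [|k IH] f g fg /=.
  move=> cf x Ux; have nx : \near x, f x = g x.
    by apply: filterS fg _; exact: open_nbhs_nbhs.
  suff : g @ x --> f x by rewrite (fg _ Ux).
  apply: cvg_trans (cf x Ux); exact: near_eq_cvg.
have nx x : U x -> \near x, f x = g x.
  by move=> Ux; apply: filterS fg _; exact: open_nbhs_nbhs.
move=> [df cf]; split=> [x Ux|v].
  by apply: near_eq_differentiable (df x Ux); exact: nx.
by apply: IH (cf v) => x Ux; apply: near_eq_derive; exact: nx.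
Qed.

Lemma Ck_sub V W k (U U' : set V) (f : V -> W) : U `<=` U' ->
  Ck k U' f -> Ck k U f.
Proof.
move=> UU'; elim: k f => [|k IH] f /=; first by move=> cf x /UU'; exact: cf.
by move=> [df cf]; split=> [x /UU'|v]; [exact: df|exact: IH].
Qed.

Lemma Ck_cst V W k (U : set V) (c : W) : Ck k U (cst c).
Proof.
elim: k c => [|k IH] c /=; first by move=> x _; exact: cst_continuous.
split=> [x _|v]; first exact: differentiable_cst.
have -> : (fun x => 'D_v (cst c) x) = cst 0 by apply/funext => x; rewrite derive_cst.
exact: IH.
Qed.

Lemma Ck_linear V W k (U : set V) (L : {linear V -> W}) :
  continuous L -> Ck k U L.
Proof.
case: k => [|k] cL /=; first by move=> x _; exact: cL.
split=> [x _|v]; first exact: linear_differentiable.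
have -> : (fun x => 'D_v L x) = cst (L v); last exact: Ck_cst.
apply/funext => x; rewrite deriveE; last exact: linear_differentiable.
by rewrite diff_lin.
Qed.

Lemma CkD V W k (U : set V) (f g : V -> W) : open U ->
  Ck k U f -> Ck k U g -> Ck k U (fun x => f x + g x).
Proof.
move=> oU; elim: k f g => [|k IH] f g /=.
  by move=> cf cg x Ux; apply: continuousD; [exact: cf|exact: cg].
move=> [df cf] [dg cg]; split=> [x Ux|v].
  by apply: differentiableD; [exact: df|exact: dg].
apply: (Ck_ext oU (f := fun x => 'D_v f x + 'D_v g x)); last exact: IH.
move=> x Ux; rewrite (@deriveD _ _ _ f g) //; apply: diff_derivable.
  exact: df.
exact: dg.
Qed.

Lemma Ck_comp_linear (V V' W W' : normedModType R) k (U : set V)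
    (f : V -> W) (L1 : {linear W -> W'}) (L2 : {linear V' -> V}) :
  open U -> continuous L1 -> continuous L2 ->
  Ck k U f -> Ck k (L2 @^-1` U) (fun x => L1 (f (L2 x))).
Proof.
move=> oU c1 c2; have oU' : open (L2 @^-1` U).
  by apply: open_comp => // x _; exact: c2.
elim: k f => [|k IH] f /=.
  move=> cf x Ux; apply: (@continuous_comp _ _ _ (f \o L2) L1).
    by apply: continuous_comp; [exact: c2|exact: cf].
  exact: c1.
move=> [df cf].
have d2 x : differentiable L2 x by exact: linear_differentiable.
have d1 y : differentiable L1 y by exact: linear_differentiable.
have dc x : U (L2 x) -> differentiable (f \o L2) x.
  by move=> Ux; apply: differentiable_comp => //; exact: df.
have dall x : U (L2 x) -> differentiable (L1 \o (f \o L2)) x.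
  by move=> Ux; apply: differentiable_comp => //; exact: dc.
split=> [x Ux|v]; first exact: dall.
apply: (Ck_ext oU' (f := fun x => L1 ('D_(L2 v) f (L2 x)))); last first.
  exact: IH (cf _).
move=> x Ux; rewrite deriveE; last exact: df.
rewrite (@deriveE _ _ _ (L1 \o (f \o L2)) x v); last exact: dall.
rewrite (diff_comp (dc x Ux) (d1 _)) /= (diff_comp (d2 x) (df _ Ux)) /=.
by rewrite !diff_lin.
Qed.

End smooth_normed.

(* A homeomorphism from an open set [cdom] of T onto an open set [cim] of R^n.
   [cmap] and [cinv] are total, their values elsewhere are irrelevant. *)
Record chart (R : realType) (T : topologicalType) (n : nat) := Chart {
  cdom : set T;
  cim : set 'rV[R]_n;
  cmap : T -> 'rV[R]_n;
  cinv : 'rV[R]_n -> T;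
  open_cdom : open cdom;
  open_cim : open cim;
  cmap_im : forall x, cdom x -> cim (cmap x);
  cinv_dom : forall z, cim z -> cdom (cinv z);
  cmapK : forall x, cdom x -> cinv (cmap x) = x;
  cinvK : forall z, cim z -> cmap (cinv z) = z;
  cmap_continuous : forall x, cdom x -> {for x, continuous cmap};
  cinv_continuous : forall z, cim z -> {for z, continuous cinv} }.

Lemma open_overlap (R : realType) (T : topologicalType) (n n' : nat)
    (c : chart R T n) (c' : chart R T n') :
  open (cim c `&` cinv c @^-1` cdom c').
Proof.
rewrite openE => z [cz c'z]; apply: filterI.
  by apply: open_nbhs_nbhs; split => //; exact: open_cim.
apply: (cinv_continuous cz); apply: open_nbhs_nbhs; split => //.
exact: open_cdom.
Qed.

(* No separation or countability axiom is imposed: the space of arrows of a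
   Lie groupoid, and the total space of a principal bundle, may fail to be
   Hausdorff. All notions below are local. *)
Record manifold (R : realType) := Manifold {
  mcarrier :> topologicalType;
  mdim : nat;
  atlas : set (chart R mcarrier mdim);
  atlas_cover : forall x, exists2 c, atlas c & cdom c x;
  atlas_compat : forall c c', atlas c -> atlas c' ->
    Cinfty (cim c `&` cinv c @^-1` cdom c') (cmap c' \o cinv c) }.

Section line.
Variable R : realType.

Lemma const_mx_continuous : continuous (fun x : R => const_mx x : 'rV[R]_1).
Proof.
move=> x A /nbhs_ballP[e /= e0 eA]; apply/nbhs_ballP; exists e => //= y xy.
by apply: eA; split => // i j; rewrite !mxE.
Qed.

Lemma entry_continuous : continuous (fun z : 'rV[R]_1 => z ord0 ord0).
Proof. by move=> z; apply: (@coord_continuous R 1 1 ord0 ord0). Qed.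

Lemma const_mxK (z : 'rV[R]_1) : const_mx (z ord0 ord0) = z.
Proof. by apply/matrixP => i j; rewrite mxE (ord1 i) (ord1 j). Qed.

Definition line_chart : chart R R 1 :=
  @Chart R R 1 setT setT (fun x => const_mx x) (fun z => z ord0 ord0)
    openT openT (fun _ _ => I) (fun _ _ => I)
    (fun x _ => mxE _ _ _ _) (fun z _ => const_mxK z)
    (fun x _ => @const_mx_continuous x) (fun z _ => @entry_continuous z).

Lemma line_cover (x : R) : exists2 c, [set line_chart] c & cdom c x.
Proof. by exists line_chart. Qed.

Lemma line_compat c c' : [set line_chart] c -> [set line_chart] c' ->
  Cinfty (cim c `&` cinv c @^-1` cdom c') (cmap c' \o cinv c).
Proof.
move=> -> -> k; have -> : cmap line_chart \o cinv line_chart = idfun.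
  by apply/funext => z; exact: const_mxK.
by apply: Ck_linear => x; exact: cvg_id.
Qed.

Definition line : manifold R := Manifold line_cover line_compat.

End line.

Section product.
Variables (R : realType).

Lemma row_mx_continuous m n : continuous
  (fun z : 'rV[R]_m * 'rV[R]_n => row_mx z.1 z.2).
Proof.
move=> [a b] A /nbhs_ballP[e /= e0 eA]; apply/nbhs_ballP; exists e => //=.
move=> [c d] [/= [_ ac] [_ bd]]; apply: eA; split => // i j.
by rewrite !mxE; case: (fintype.split j) => k; [exact: ac|exact: bd].
Qed.

Section chart.
Variables (S T : topologicalType) (m n : nat) (c : chart R S m) (d : chart R T n).

Let dom : set (S * T) := cdom c `*` cdom d.
Let im : set 'rV[R]_(m + n) := lsubmx @^-1` cim c `&` rsubmx @^-1` cim d.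
Let map (p : S * T) : 'rV[R]_(m + n) := row_mx (cmap c p.1) (cmap d p.2).
Let inv (z : 'rV[R]_(m + n)) : S * T := (cinv c (lsubmx z), cinv d (rsubmx z)).

Let open_dom : open dom.
Proof.
rewrite openE => -[x y] [/= cx dy]; exists (cdom c, cdom d) => //=.
by split; apply: open_nbhs_nbhs; split => //; exact: open_cdom.
Qed.

Let open_im : open im.
Proof.
apply: openI.
  by apply: open_comp => [x _|]; [exact: continuous_lsubmx|exact: open_cim].
by apply: open_comp => [x _|]; [exact: continuous_rsubmx|exact: open_cim].
Qed.

Let map_im p : dom p -> im (map p).
Proof. by move=> [? ?]; split; rewrite /= ?row_mxKl ?row_mxKr; exact: cmap_im. Qed.

Let inv_dom z : im z -> dom (inv z).
Proof. by move=> [? ?]; split; exact: cinv_dom. Qed.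

Let mapK p : dom p -> inv (map p) = p.
Proof. by case: p => x y [? ?]; rewrite /inv row_mxKl row_mxKr !cmapK. Qed.

Let invK z : im z -> map (inv z) = z.
Proof. by move=> [? ?]; rewrite /map !cinvK ?hsubmxK. Qed.

Let map_continuous p : dom p -> {for p, continuous map}.
Proof.
case: p => x y [/= cx dy].
have h1 : (cmap c \o fst) q @[q --> (x, y)] --> cmap c x.
  by apply: continuous_comp; [exact: cvg_fst|exact: cmap_continuous].
have h2 : (cmap d \o snd) q @[q --> (x, y)] --> cmap d y.
  by apply: continuous_comp; [exact: cvg_snd|exact: cmap_continuous].
pose f (q : S * T) := (cmap c q.1, cmap d q.2).
have hf : {for (x, y), continuous f} by exact: (cvg_pair h1 h2).
exact: (continuous_comp hf (@row_mx_continuous m n (f (x, y)))).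
Qed.

Let inv_continuous z : im z -> {for z, continuous inv}.
Proof.
move=> [cz dz].
have h1 : (cinv c \o lsubmx) w @[w --> z] --> cinv c (lsubmx z).
  by apply: continuous_comp; [exact: continuous_lsubmx|exact: cinv_continuous].
have h2 : (cinv d \o rsubmx) w @[w --> z] --> cinv d (rsubmx z).
  by apply: continuous_comp; [exact: continuous_rsubmx|exact: cinv_continuous].
exact: (cvg_pair h1 h2).
Qed.

Definition prod_chart : chart R (S * T)%type (m + n) :=
  Chart open_dom open_im map_im inv_dom mapK invK map_continuous inv_continuous.

End chart.

Variables M N : manifold R.

Definition prod_atlas : set (chart R (M * N)%type (mdim M + mdim N)) :=
  [set e | exists c d, [/\ atlas c, atlas d & e = prod_chart c d]].

Lemma prod_cover (p : (M * N)%type) : exists2 e, prod_atlas e & cdom e p.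
Proof.
have [c ac cx] := atlas_cover p.1; have [d ad dy] := atlas_cover p.2.
by exists (prod_chart c d) => //; exists c, d.
Qed.

Definition row_mx0r m n (u : 'rV[R]_m) : 'rV[R]_(m + n) := row_mx u 0.
Definition row_mx0l m n (u : 'rV[R]_n) : 'rV[R]_(m + n) := row_mx 0 u.

Lemma row_mx0r_continuous m n :
  continuous (@row_mx0r m n).
Proof.
move=> u A /nbhs_ballP[e /= e0 eA]; apply/nbhs_ballP; exists e => //= v [_ uv].
apply: eA; split => // i j; rewrite !mxE.
by case: (fintype.split j) => k; [exact: uv|exact: ballxx].
Qed.

Lemma row_mx0l_continuous m n :
  continuous (@row_mx0l m n).
Proof.
move=> u A /nbhs_ballP[e /= e0 eA]; apply/nbhs_ballP; exists e => //= v [_ uv].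
apply: eA; split => // i j; rewrite !mxE.
by case: (fintype.split j) => k; [exact: ballxx|exact: uv].
Qed.

Lemma row_mx0r_linear m n :
  linear (@row_mx0r m n).
Proof. by move=> a u v; rewrite /row_mx0r scale_row_mx add_row_mx scaler0 addr0. Qed.

Lemma row_mx0l_linear m n :
  linear (@row_mx0l m n).
Proof. by move=> a u v; rewrite /row_mx0l scale_row_mx add_row_mx scaler0 addr0. Qed.

HB.instance Definition _ m n := GRing.isLinear.Build R 'rV[R]_m 'rV[R]_(m + n)
  _ _ (@row_mx0r_linear m n).
HB.instance Definition _ m n := GRing.isLinear.Build R 'rV[R]_n 'rV[R]_(m + n)
  _ _ (@row_mx0l_linear m n).

Lemma prod_compat e e' : prod_atlas e -> prod_atlas e' ->
  Cinfty (cim e `&` cinv e @^-1` cdom e') (cmap e' \o cinv e).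
Proof.
move=> [c [d [ac ad ->]]] [c' [d' [ac' ad' ->]]] k.
pose A := cim c `&` cinv c @^-1` cdom c'.
pose B := cim d `&` cinv d @^-1` cdom d'.
have oA : open A by exact: open_overlap.
have oB : open B by exact: open_overlap.
have cl := @continuous_lsubmx R 1 (mdim M) (mdim N).
have cr := @continuous_rsubmx R 1 (mdim M) (mdim N).
have oU : open (cim (prod_chart c d) `&`
    cinv (prod_chart c d) @^-1` cdom (prod_chart c' d')) by exact: open_overlap.
apply: (Ck_ext oU (f := fun z =>
  row_mx ((cmap c' \o cinv c) (lsubmx z)) 0 +
  row_mx 0 ((cmap d' \o cinv d) (rsubmx z)))).
  by move=> z _; rewrite add_row_mx addr0 add0r.
apply: CkD => //.
  apply: (@Ck_sub _ _ _ _ _ (lsubmx @^-1` A)); first by move=> z [[? ?] [? ?]].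
  apply: (Ck_comp_linear (f := cmap c' \o cinv c)
    (L1 := @row_mx0r _ _) (L2 := lsubmx)) => //.
    exact: row_mx0r_continuous.
  exact: atlas_compat.
apply: (@Ck_sub _ _ _ _ _ (rsubmx @^-1` B)); first by move=> z [[? ?] [? ?]].
apply: (Ck_comp_linear (f := cmap d' \o cinv d)
  (L1 := @row_mx0l _ _) (L2 := rsubmx)) => //.
  exact: row_mx0l_continuous.
exact: atlas_compat.
Qed.

Definition prod_manifold : manifold R := Manifold prod_cover prod_compat.

End product.

Section smooth_maps.
Context {R : realType}.
Implicit Types M N : manifold R.

(* By [atlas_compat] it would be the same to ask for one pair of charts. *)
Definition smooth_at M N (f : M -> N) (x : M) : Prop :=
  {for x, continuous f} /\
  forall c c', atlas c -> atlas c' -> cdom c x -> cdom c' (f x) ->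
    exists2 U, open_nbhs (cmap c x) U & Cinfty U (cmap c' \o f \o cinv c).

Definition smooth M N (f : M -> N) : Prop := forall x, smooth_at f x.

Definition local_extension M N (D : set M) (f : M -> N) (x : M) :
    set (M -> N) :=
  [set h | smooth_at h x /\ \forall y \near x, D y -> h y = f y].

(* Smoothness of a map defined on an arbitrary subset. On an open subset this
   is smoothness at each point; on an embedded submanifold, such as a fibre
   product along a submersion or a fibre of a submersion, it is smoothness for
   the induced structure. *)
Definition smooth_on M N (D : set M) (f : M -> N) : Prop :=
  forall x, D x -> local_extension D f x !=set0.

Definition diffeo_on M N (A : set M) (B : set N) (f : M -> N) : Prop :=
  exists g : N -> M,
    [/\ smooth_on A f, smooth_on B g,
        forall x, A x -> B (f x) /\ g (f x) = x &
        forall y, B y -> A (g y) /\ f (g y) = y].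

(* A tangent vector at x is the operator f |-> (f \o c)'(0), on functions f
   smooth at x, given by a smooth curve c through x. So that an operator is
   determined by its values on functions smooth at x, it is set to 0 on the
   others. *)
Definition tvec M : Type := (M -> R) -> R^o.

Definition smooth_fun_at M (f : M -> R) (x : M) : Prop :=
  @smooth_at M (line R) f x.

Definition smooth_curve_at M (c : R -> M) (t : R) : Prop :=
  @smooth_at (line R) M c t.

Definition velocity M (c : R -> M) (t : R) : tvec M :=
  fun f => if `[< smooth_fun_at f (c t) >] then (f \o c)^`()%classic t else 0.

Definition tangent M (x : M) : set (tvec M) :=
  [set v | exists c, [/\ smooth_curve_at c 0, c 0 = x & v = velocity c 0]].

Definition push M N (f : M -> N) (x : M) (v : tvec M) : tvec N :=
  fun h => if `[< smooth_fun_at h (f x) >] then v (h \o f) else 0.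

(* Differential at x of a map that is smooth on a subset D. For v tangent to D
   the choice of the local extension does not matter. *)
Definition push_on M N (D : set M) (f : M -> N) (x : M) (v : tvec M) : tvec N :=
  push (xget f (local_extension D f x)) x v.

Definition submersion M N (f : M -> N) : Prop :=
  smooth f /\
  forall x w, tangent (f x) w -> exists2 v, tangent x v & push f x v = w.

Definition smooth_vector_field M (U : set M) (X : M -> tvec M) : Prop :=
  forall x, U x -> tangent x (X x) /\
    forall f, smooth_fun_at f x -> smooth_fun_at (fun y => X y f) x.

Definition lie_bracket M (X Y : M -> tvec M) : M -> tvec M :=
  fun x f => if `[< smooth_fun_at f x >]
    then X x (fun y => Y y f) - Y x (fun y => X y f) else 0.

Definition subbundle M (H : M -> set (tvec M)) : Prop :=
  forall x, exists U k (X : 'I_k -> M -> tvec M),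
    [/\ open_nbhs x U,
        forall i, smooth_vector_field U (X i),
        forall y (a : 'I_k -> R), U y ->
          \sum_i a i *: X i y = 0 -> forall i, a i = 0 &
        forall y, U y -> H y = [set \sum_i a i *: X i y | a in [set: 'I_k -> R]]].

Definition fibre_bundle (P M : manifold R) (p : P -> M) : Prop :=
  smooth p /\
  forall m, exists (F : manifold R) (U : set M) (Phi : P -> prod_manifold M F),
    [/\ open_nbhs m U, diffeo_on (N := prod_manifold M F) (p @^-1` U) [set y | U y.1] Phi &
        forall x, U (p x) -> (Phi x).1 = p x].

End smooth_maps.

(* The product [gmul g h] is total, but only constrained when
   [gtgt g = gsrc h]. *)
Record lie_groupoid (R : realType) := LieGroupoid {
  arrows : manifold R;
  objects : manifold R;
  gsrc : arrows -> objects;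
  gtgt : arrows -> objects;
  gunit : objects -> arrows;
  ginv : arrows -> arrows;
  gmul : arrows -> arrows -> arrows;
  gsrc_unit : forall x, gsrc (gunit x) = x;
  gtgt_unit : forall x, gtgt (gunit x) = x;
  gsrc_inv : forall g, gsrc (ginv g) = gtgt g;
  gtgt_inv : forall g, gtgt (ginv g) = gsrc g;
  gsrc_mul : forall g h, gtgt g = gsrc h -> gsrc (gmul g h) = gsrc g;
  gtgt_mul : forall g h, gtgt g = gsrc h -> gtgt (gmul g h) = gtgt h;
  gmulA : forall g h k, gtgt g = gsrc h -> gtgt h = gsrc k ->
    gmul g (gmul h k) = gmul (gmul g h) k;
  gmul1l : forall g, gmul (gunit (gsrc g)) g = g;
  gmul1r : forall g, gmul g (gunit (gtgt g)) = g;
  gmulV : forall g, gmul g (ginv g) = gunit (gsrc g);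
  gmulVl : forall g, gmul (ginv g) g = gunit (gtgt g);
  gsrc_submersion : submersion gsrc;
  gtgt_submersion : submersion gtgt;
  gunit_smooth : smooth gunit;
  ginv_smooth : smooth ginv;
  gmul_smooth :
    smooth_on (M := prod_manifold arrows arrows) (N := arrows)
      [set gh | gtgt gh.1 = gsrc gh.2] (fun gh => gmul gh.1 gh.2) }.

Arguments gunit {R} l x.

Section groupoid.
Context {R : realType}.
Variable G : lie_groupoid R.

Definition lie_algebroid (x : objects G) : set (tvec (arrows G)) :=
  [set v | tangent (gunit G x) v /\ push (@gsrc R G) (gunit G x) v = 0].

Definition bisection (U : set (objects G)) (b : objects G -> arrows G) : Prop :=
  [/\ open U, smooth_on U b, forall x, U x -> gsrc (b x) = x &
      exists2 V, open V & diffeo_on U V (@gtgt R G \o b)].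

(* The bisection [gam m] is defined on the slice of D over m. *)
Definition smooth_bisection_map (M : manifold R)
    (D : set (prod_manifold M (objects G)))
    (gam : M -> objects G -> arrows G) : Prop :=
  [/\ open D,
      smooth_on (M := prod_manifold M (objects G)) D (fun mx => gam mx.1 mx.2) &
      forall m, bisection [set x | D (m, x)] (gam m)].

Definition conj_bisection (b : objects G -> arrows G) (g : arrows G) :
    arrows G :=
  gmul (ginv (b (gsrc g))) (gmul g (b (gtgt g))).

Definition Ad_inv (b : objects G -> arrows G) (x : objects G)
    (v : tvec (arrows G)) : tvec (arrows G) :=
  push (conj_bisection b) (gunit G x) v.

End groupoid.

(* As for [gmul], [act p g] is total but only constrained when
   [moment p = gsrc g]. *)
Record principal_bundle (R : realType) (G : lie_groupoid R) (P M : manifold R)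
    := PrincipalBundle {
  bproj : P -> M;
  moment : P -> objects G;
  act : P -> arrows G -> P;
  proj_bundle : fibre_bundle bproj;
  moment_smooth : smooth moment;
  act_smooth :
    smooth_on (M := prod_manifold P (arrows G)) (N := P)
      [set pg | moment pg.1 = gsrc pg.2] (fun pg => act pg.1 pg.2);
  moment_act : forall p g, moment p = gsrc g -> moment (act p g) = gtgt g;
  act1 : forall p, act p (gunit G (moment p)) = p;
  actM : forall p g h, moment p = gsrc g -> gtgt g = gsrc h ->
    act p (gmul g h) = act (act p g) h;
  proj_act : forall p g, moment p = gsrc g -> bproj (act p g) = bproj p;
  act_principal :
    diffeo_on (M := prod_manifold P (arrows G)) (N := prod_manifold P P)
      [set pg | moment pg.1 = gsrc pg.2] [set pq | bproj pq.1 = bproj pq.2]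
      (fun pg => (pg.1, act pg.1 pg.2)) }.

Section connections.
Context {R : realType} {G : lie_groupoid R} {P M : manifold R}.
Variables (B : principal_bundle G P M) (H : P -> set (tvec P)).

Definition division (p q : P) : arrows G :=
  xget (gunit G (moment B p))
    [set g | moment B p = gsrc g /\ act B p g = q].

Definition vertical (p : P) : set (tvec P) :=
  [set v | tangent p v /\ push (bproj B) p v = 0].

(* The differential of [division p], defined on the fibre through p. *)
Definition push_division (p : P) (v : tvec P) : tvec (arrows G) :=
  push_on [set q | bproj B p = bproj B q] (division p) p v.

Definition horizontal_distribution : Prop :=
  [/\ subbundle H,
      forall p v, vertical p v -> H p v -> v = 0 &
      forall p v, tangent p v ->
        exists a b, [/\ vertical p a, H p b & v = a + b]].

Definition Ver (p : P) (v : tvec P) : tvec P :=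
  xget 0 [set a | vertical p a /\ H p (v - a)].

Definition Hor (p : P) (v : tvec P) : tvec P := v - Ver p v.

Definition connection_form (p : P) (v : tvec P) : tvec (arrows G) :=
  push_division p (Ver p v).

Definition moerdijk_mrcun : Prop :=
  forall p v, H p v -> push (moment B) p v = 0.

(* mu_*(v, 0_g); the vector (v, 0_g) is the image of v under q |-> (q, g). *)
Definition push_act (g : arrows G) (p : P) (v : tvec P) : tvec P :=
  push_on (M := prod_manifold P (arrows G)) (N := P)
    [set qh | moment B qh.1 = gsrc qh.2] (fun qh => act B qh.1 qh.2) (p, g)
    (push (N := prod_manifold P (arrows G)) (fun q => (q, g)) p v).

Definition principal_connection : Prop :=
  [/\ horizontal_distribution, moerdijk_mrcun &
      forall p g, moment B p = gsrc g -> H (act B p g) = push_act g p @` H p].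

(* The set below is a singleton: the value does not depend on the chosen
   extensions of u and v to vector fields X and Y near p. *)
Definition ehresmann_curvature (p : P) (u v : tvec P) : tvec P :=
  xget 0 [set w | exists U X Y,
    [/\ open_nbhs p U, smooth_vector_field U X, smooth_vector_field U Y,
        X p = u /\ Y p = v &
        w = - Ver p (lie_bracket (fun q => Hor q (X q))
                                 (fun q => Hor q (Y q)) p)]].

Definition curvature (p : P) (u v : tvec P) : tvec (arrows G) :=
  push_division p (ehresmann_curvature p u v).

Definition local_connection_form (sigma : M -> P) (m : M) (X : tvec M) :
    tvec (arrows G) :=
  connection_form (sigma m) (push sigma m X).

Definition local_curvature (sigma : M -> P) (m : M) (X Y : tvec M) :
    tvec (arrows G) :=
  curvature (sigma m) (push sigma m X) (push sigma m Y).

Definition gauge_section (sigma : M -> P) (gam : M -> objects G -> arrows G)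
    (m : M) : P :=
  act B (sigma m) (gam m (moment B (sigma m))).

(* (gamma^-1 gamma')(X), computed with a path x through x(0). *)
Definition log_derivative (sigma : M -> P) (gam : M -> objects G -> arrows G)
    (x : R -> M) : tvec (arrows G) :=
  let y := moment B (sigma (x 0)) in
  velocity (fun tau => gmul (ginv (gam (x 0) y)) (gam (x tau) y)) 0.

End connections.

(* Main.v *)
From HB Require Import structures.
Require Import Defs.
From mathcomp Require Import all_boot all_order all_algebra.
From mathcomp Require Import all_classical all_reals all_analysis.

Set Implicit Arguments.
Unset Strict Implicit.
Unset Printing Implicit Defensive.

Import Order.TTheory GRing.Theory Num.Theory numFieldNormedType.Exports.

Local Open Scope classical_set_scope.
Local Open Scope ring_scope.

(* Fix m, let p = sigma m, b = gamma m, and F q = q . b (epsilon q). Since b is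
   a bisection, F is a diffeomorphism near p, and it covers the identity of M.
   As epsilon_* H = 0, the differential of F on H is (R_b)_*, so F maps H to H.
   On the fibre through p, division by F p turns F into conjugation by b, hence
   intertwines the differentials of the division maps with Ad.
   The curve sigma_gamma (x s) = sigma (x s) . gamma (x s) (epsilon (sigma (x s)))
   has velocity F_* (sigma_* X) + u, where u is the velocity of
   p . gamma (x s) (epsilon p); u is vertical and corresponds to
   (gamma^-1 gamma') (X). Taking vertical parts gives the first formula. Taking
   horizontal parts, Hor (sigma_gamma_* X) = F_* (Hor (sigma_* X)); the
   curvature is natural under F and depends only on the horizontal parts of its
   arguments, which gives the second. *)

(** * Calculus of C^k maps *)

(** The main tool is [velocity_pair]: for a map of two arguments, the velocity along a pair of
    curves is the sum of the two partial velocities. It makes tangent vectors, which are given by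
    curves, closed under addition; it compares [F] with right translation on [H], the other partial
    velocity being an image of [epsilon_* v = 0]; it splits off the vertical term [u]; and it
    represents a vertical vector by a curve inside a fibre. The obstacle in the curvature is that it
    is computed with arbitrary extensions of its arguments: those at [F p] are not images of those
    at [p], and only the horizontal parts correspond, at the point alone. Both pairs are expanded in
    a frame of [H] and in its image. The coefficients agree at the point, and their derivatives only
    contribute combinations of the frame, which are horizontal. A bracket is never shown to be a
    tangent vector: it is enough that it depends on germs and vanishes on functions that are not
    smooth. *)

Section Ck_calculus.
Context {R : realType}.
Implicit Types V W : normedModType R.

Lemma Ck_pred V W k (U : set V) (f : V -> W) : Ck k.+1 U f -> Ck k U f.
Proof.
elim: k f => [|k IH] f /= [df cf].
  by move=> x Ux; apply: differentiable_continuous; exact: df.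
by split=> // v; apply: IH; exact: cf.
Qed.

Lemma CkM V k (U : set V) (f g : V -> R^o) : open U ->
  Ck k U f -> Ck k U g -> Ck k U (fun x => f x * g x : R^o).
Proof.
move=> oU; elim: k f g => [|k IH] f g.
  by move=> cf cg x Ux; apply: continuousM; [exact: cf|exact: cg].
move=> kf kg; have := Ck_pred kf; have := Ck_pred kg.
case: kf kg => [df cf] [dg cg] kf kg; split=> [x Ux|v].
  by apply: differentiableM; [exact: df|exact: dg].
apply: (Ck_ext oU (f := fun x => (f x * 'D_v g x : R^o) + (g x * 'D_v f x : R^o))).
  move=> x Ux; rewrite (@deriveM _ _ f g) //; apply: diff_derivable.
    exact: df.
  exact: dg.
apply: CkD => //.
  exact: (IH _ _ kg (cg v)).
exact: (IH _ _ kf (cf v)).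
Qed.

Lemma Ck_sum V W k (U : set V) n (f : 'I_n -> V -> W) : open U ->
  (forall i, Ck k U (f i)) -> Ck k U (fun x => \sum_i f i x).
Proof.
move=> oU; elim: n f => [|n IH] f kf.
  apply: (Ck_ext oU (f := cst 0)); last exact: Ck_cst.
  by move=> x _; rewrite big_ord0.
apply: (Ck_ext oU (f := fun x => f ord0 x + \sum_i f (lift ord0 i) x)).
  by move=> x _; rewrite big_ord_recl.
by apply: CkD => //; apply: IH.
Qed.

Lemma Ck_post V W W' k (U : set V) (f : V -> W) (L : {linear W -> W'}) :
  open U -> continuous L -> Ck k U f -> Ck k U (fun x => L (f x)).
Proof.
move=> oU cL kf.
by apply: (@Ck_comp_linear _ V V W W' k U f L idfun) => // x; exact: cvg_id.
Qed.

Lemma Ck_scalel V W k (U : set V) (f : V -> R^o) (w : W) : open U ->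
  Ck k U f -> Ck k U (fun x => (f x : R) *: w).
Proof.
move=> oU kf.
have lin : linear (fun t : R^o => (t : R) *: w).
  by move=> a u v; rewrite scalerDl scalerA.
pose L : {linear R^o -> W} := HB.pack (fun t : R^o => (t : R) *: w)
  (GRing.isLinear.Build _ _ _ _ _ lin).
by apply: (Ck_post (L := L)) => //; exact: scalel_continuous.
Qed.

Lemma Ck_coord V k (U : set V) n (f : V -> 'rV[R]_n) : open U ->
  (forall i, Ck k U (fun x => f x ord0 i : R^o)) -> Ck k U f.
Proof.
move=> oU kf.
apply: (Ck_ext oU (f := fun x => \sum_i (f x ord0 i *: delta_mx ord0 i : 'rV[R]_n))).
  by move=> x _; rewrite [RHS]row_sum_delta.
by apply: Ck_sum => // i; exact: Ck_scalel.
Qed.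

Lemma Ck_entry V k (U : set V) n (f : V -> 'rV[R]_n) i : open U ->
  Ck k U f -> Ck k U (fun x => f x ord0 i : R^o).
Proof.
move=> oU kf.
have lin : linear (fun z : 'rV[R]_n => z ord0 i : R^o).
  by move=> a u v; rewrite !mxE.
pose L : {linear 'rV[R]_n -> R^o} := HB.pack (fun z : 'rV[R]_n => z ord0 i : R^o)
  (GRing.isLinear.Build _ _ _ _ _ lin).
by apply: (Ck_post (L := L)) => //; exact: coord_continuous.
Qed.

(** The derivative of [g] is taken in the direction ['D_v f x], which moves with [x], whereas [Ck]
    speaks of fixed directions only. Expanding in the standard basis leaves fixed directions with
    variable coefficients. *)
Lemma derive_comp V W n (f : V -> 'rV[R]_n) (g : 'rV[R]_n -> W) x v :
  differentiable f x -> differentiable g (f x) ->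
  'D_v (g \o f) x = \sum_i 'D_v f x ord0 i *: 'D_(delta_mx ord0 i) g (f x).
Proof.
move=> df dg.
rewrite deriveE; last exact: differentiable_comp.
rewrite diff_comp //= -(deriveE v df) [X in _ X = _]row_sum_delta linear_sum.
by apply: eq_bigr => i _; rewrite linearZ (deriveE _ dg).
Qed.

(** Scalar values come first, so that the terms of [derive_comp] are products covered by [CkM];
    [Ck_comp] then works entry by entry. *)
Lemma Ck_compR V k (U : set V) n (U' : set 'rV[R]_n) (f : V -> 'rV[R]_n)
    (g : 'rV[R]_n -> R^o) :
  open U -> U `<=` f @^-1` U' -> Ck k U f -> Ck k U' g -> Ck k U (g \o f).
Proof.
move=> oU UU'; elim: k f g UU' => [|k IH] f g UU'.
  by move=> cf cg x Ux; apply: continuous_comp; [exact: cf|exact/cg/UU'].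
move=> kf kg; have kf' := Ck_pred kf.
case: kf kg => [df cf] [dg cg]; split=> [x Ux|v].
  by apply: differentiable_comp; [exact: df|exact/dg/UU'].
apply: (Ck_ext oU (f := fun x => \sum_i ('D_v f x ord0 i *
    'D_(delta_mx ord0 i) g (f x) : R^o))).
  by move=> x Ux; rewrite derive_comp //; [exact: df|exact/dg/UU'].
apply: Ck_sum => // i; apply: CkM => //; first exact: Ck_entry (cf v).
exact: (IH f _ UU' kf' (cg _)).
Qed.

Lemma Ck_comp V k (U : set V) n m (U' : set 'rV[R]_n) (f : V -> 'rV[R]_n)
    (g : 'rV[R]_n -> 'rV[R]_m) :
  open U -> open U' -> U `<=` f @^-1` U' -> Ck k U f -> Ck k U' g ->
  Ck k U (g \o f).
Proof.
move=> oU oU' UU' kf kg; apply: Ck_coord => // i.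
exact: (Ck_compR (g := fun z => g z ord0 i) oU UU' kf (Ck_entry _ _ kg)).
Qed.

Lemma CkV V k (U : set V) (f : V -> R^o) : open U ->
  (forall x, U x -> f x != 0) -> Ck k U f -> Ck k U (fun x => (f x)^-1 : R^o).
Proof.
move=> oU f0; elim: k => [|k IH].
  by move=> cf x Ux; apply: continuousV; [exact: f0|exact: cf].
move=> kf; have kf' := IH (Ck_pred kf); case: kf => df cf; split=> [x Ux|v].
  by apply: differentiableV; [exact: df|exact: f0].
(* The sign of the derivative of the inverse is absorbed in the direction [- v], which leaves a
   plain product for [CkM]. *)
apply: (Ck_ext oU (f := fun x => ((f x)^-1 * ((f x)^-1 * 'D_(- v) f x : R^o) : R^o))).
  move=> x Ux; rewrite (@deriveV _ _ f) ?f0 //; last exact/diff_derivable/df.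
  rewrite !deriveE; [|exact: df..].
  by rewrite linearN mulrA -expr2 exprVn mulrN scaleNr.
by apply: (CkM oU kf' (CkM oU kf' (cf _))).
Qed.

End Ck_calculus.

(** * Germs of smooth maps between normed spaces *)

Section Cinfty_near.
Context {R : realType}.
Implicit Types V W : normedModType R.

(** One neighbourhood serves all orders [k], exactly as [smooth_at] asks of a coordinate
    expression. *)
Definition Cinfty_at V W (f : V -> W) (x : V) : Prop :=
  exists2 U, open_nbhs x U & Cinfty U f.

Lemma Cinfty_at_near V W (f : V -> W) (x : V) :
  Cinfty_at f x -> \near x, Cinfty_at f x.
Proof.
move=> [U [oU Ux] sU]; apply: filterS (open_nbhs_nbhs (conj oU Ux)) => y Uy.
by exists U.
Qed.

Lemma Cinfty_at_ext V W (f g : V -> W) (x : V) :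
  (\near x, f x = g x) -> Cinfty_at f x -> Cinfty_at g x.
Proof.
move=> fg [U [oU Ux] sU]; exists (U `&` [set y | f y = g y]^°).
  split; first by apply: openI => //; exact: open_interior.
  by split.
move=> k; apply: (@Ck_ext _ _ _ _ _ f).
- by apply: openI => //; exact: open_interior.
- by move=> y [_ /interior_subset].
- by apply: (Ck_sub (U' := U)) => // y [].
Qed.

Lemma Cinfty_at_eqfun V W (f g : V -> W) (x : V) :
  f =1 g -> Cinfty_at f x -> Cinfty_at g x.
Proof. by move=> /funext ->. Qed.

Lemma Cinfty_at_differentiable V W (f : V -> W) (x : V) :
  Cinfty_at f x -> differentiable f x.
Proof. by move=> [U [oU Ux] sU]; have [df _] := sU 1; exact: df. Qed.

Lemma Cinfty_at_continuous V W (f : V -> W) (x : V) :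
  Cinfty_at f x -> {for x, continuous f}.
Proof. by move/Cinfty_at_differentiable/differentiable_continuous. Qed.

Lemma Cinfty_at_derive V W (f : V -> W) (v x : V) :
  Cinfty_at f x -> Cinfty_at (fun x => 'D_v f x) x.
Proof. by move=> [U Ux sU]; exists U => // k; have [_ /(_ v)] := sU k.+1. Qed.

Lemma Cinfty_at_cst V W (w : W) (x : V) : Cinfty_at (cst w) x.
Proof.
by exists setT; [split => //; exact: openT|move=> k; exact: Ck_cst].
Qed.

Lemma Cinfty_at_linear V W (L : {linear V -> W}) x :
  continuous L -> Cinfty_at L x.
Proof.
move=> cL; exists setT; [by split => //; exact: openT|move=> k].
exact: Ck_linear.
Qed.

Lemma Cinfty_at2 V W1 W2 W (f : V -> W1) (g : V -> W2) (h : V -> W) x :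
  (forall k U, open U -> Ck k U f -> Ck k U g -> Ck k U h) ->
  Cinfty_at f x -> Cinfty_at g x -> Cinfty_at h x.
Proof.
move=> H [U [oU Ux] sU] [U' [oU' Ux'] sU']; exists (U `&` U').
  by split; [exact: openI|].
move=> k; apply: H; first exact: openI.
  by apply: (Ck_sub (U' := U)) => // y [].
by apply: (Ck_sub (U' := U')) => // y [].
Qed.

Lemma Cinfty_atD V W (f g : V -> W) x :
  Cinfty_at f x -> Cinfty_at g x -> Cinfty_at (fun x => f x + g x) x.
Proof. by apply: Cinfty_at2 => k U; exact: CkD. Qed.

Lemma Cinfty_atM V (f g : V -> R^o) x :
  Cinfty_at f x -> Cinfty_at g x -> Cinfty_at (fun x => f x * g x : R^o) x.
Proof. by apply: Cinfty_at2 => k U; exact: CkM. Qed.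

Lemma Cinfty_at_post V W W' (f : V -> W) (L : {linear W -> W'}) x :
  continuous L -> Cinfty_at f x -> Cinfty_at (fun x => L (f x)) x.
Proof.
move=> cL [U Ux sU]; exists U => // k; apply: Ck_post => //.
by case: Ux.
Qed.

Lemma Cinfty_at_scalel V W (f : V -> R^o) (w : W) x :
  Cinfty_at f x -> Cinfty_at (fun x => (f x : R) *: w) x.
Proof.
by move=> [U Ux sU]; exists U => // k; apply: Ck_scalel => //; case: Ux.
Qed.

Lemma Cinfty_atV V (f : V -> R^o) x : f x != 0 ->
  Cinfty_at f x -> Cinfty_at (fun x => (f x)^-1 : R^o) x.
Proof.
move=> f0 sf; have cf := Cinfty_at_continuous sf.
case: sf => U [oU Ux] sU.
have n0 : \near x, f x != 0 by exact: (cvgr_neq0 _ cf).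
exists (U `&` [set y | f y != 0]^°).
  split; first by apply: openI => //; exact: open_interior.
  by split.
move=> k; apply: CkV; first by apply: openI => //; exact: open_interior.
  by move=> y [_ /interior_subset].
by apply: (Ck_sub (U' := U)) => // y [].
Qed.

Lemma Cinfty_at_comp V n m (f : V -> 'rV[R]_n) (g : 'rV[R]_n -> 'rV[R]_m) x :
  Cinfty_at f x -> Cinfty_at g (f x) -> Cinfty_at (g \o f) x.
Proof.
move=> sf [U' [oU' Ux'] sU']; have cf := Cinfty_at_continuous sf.
case: sf => U [oU Ux] sU.
have nU' : \near x, U' (f x) by apply: cf; exact: open_nbhs_nbhs.
exists (U `&` (f @^-1` U')^°).
  split; first by apply: openI => //; exact: open_interior.
  by split.
move=> k; apply: (Ck_comp (U' := U')) => //.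
- by apply: openI => //; exact: open_interior.
- by move=> y [_ /interior_subset].
- by apply: (Ck_sub (U' := U)) => // y [].
Qed.

Lemma Cinfty_at_entry V n (f : V -> 'rV[R]_n) i x :
  Cinfty_at f x -> Cinfty_at (fun x => f x ord0 i : R^o) x.
Proof.
by move=> [U Ux sU]; exists U => // k; apply: Ck_entry => //; case: Ux.
Qed.

End Cinfty_near.

(** * Smooth maps between manifolds *)

Section smooth_at_theory.
Context {R : realType}.
Implicit Types M N L : manifold R.

Lemma near_cinv (T : topologicalType) n (c : chart R T n) x (Q : set T) :
  cdom c x -> (\near x, Q x) -> \forall z \near cmap c x, Q (cinv c z).
Proof.
move=> cx Qx; have := cinv_continuous (cmap_im cx).
rewrite /prop_for /continuous_at (cmapK cx); exact.
Qed.

Lemma near_cdom (T : topologicalType) n (c : chart R T n) x :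
  cdom c x -> \near x, cdom c x.
Proof.
by move=> cx; apply: open_nbhs_nbhs; split => //; exact: open_cdom.
Qed.

Lemma near_cim (T : topologicalType) n (c : chart R T n) z :
  cim c z -> \near z, cim c z.
Proof.
by move=> cx; apply: open_nbhs_nbhs; split => //; exact: open_cim.
Qed.

Lemma Cinfty_at_transition M (c c' : chart R M (mdim M)) x :
  atlas c -> atlas c' -> cdom c x -> cdom c' x ->
  Cinfty_at (cmap c' \o cinv c) (cmap c x).
Proof.
move=> ac ac' cx c'x; exists (cim c `&` cinv c @^-1` cdom c').
  split; first exact: open_overlap.
  by split; [exact: cmap_im|rewrite /= cmapK].
exact: atlas_compat.
Qed.

(** Other charts change the coordinate expression by a transition map on either side. Continuity of
    [f] keeps nearby values in the domain of [c'], where the inserted chart and its inverse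
    cancel. *)
Lemma smooth_atP M N (f : M -> N) x c c' : atlas c -> atlas c' ->
  cdom c x -> cdom c' (f x) ->
  smooth_at f x <-> {for x, continuous f} /\
    Cinfty_at (cmap c' \o f \o cinv c) (cmap c x).
Proof.
move=> ac ac' cx cfx; split=> [[cf /(_ _ _ ac ac' cx cfx)]//|[cf sf]].
split=> // d d' ad ad' dx dfx.
have sE : Cinfty_at ((cmap d' \o cinv c') \o ((cmap c' \o f \o cinv c) \o
    (cmap c \o cinv d))) (cmap d x).
  apply: Cinfty_at_comp; last first.
    by rewrite /= !(cmapK dx) (cmapK cx); exact: Cinfty_at_transition.
  apply: Cinfty_at_comp; first exact: Cinfty_at_transition.
  by rewrite /= (cmapK dx).
apply: Cinfty_at_ext sE.
have nd : \forall z \near cmap d x, cdom c (cinv d z) /\ cdom c' (f (cinv d z)).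
  apply: (near_cinv (Q := fun y => cdom c y /\ cdom c' (f y)) dx).
  apply: filterI; first exact: near_cdom.
  by apply: cf; exact: near_cdom.
by apply: filterS nd => z [h1 h2] /=; rewrite (cmapK h1) (cmapK h2).
Qed.

Lemma smooth_at_continuous M N (f : M -> N) x :
  smooth_at f x -> {for x, continuous f}.
Proof. by case. Qed.

Lemma smooth_at_comp M N L (f : M -> N) (g : N -> L) x :
  smooth_at f x -> smooth_at g (f x) -> smooth_at (g \o f) x.
Proof.
move=> sf sg.
have [c ac cx] := atlas_cover x; have [c' ac' cx'] := atlas_cover (f x).
have [d ad dx] := atlas_cover (g (f x)).
move/(smooth_atP ac ac' cx cx'): sf => [cf sf].
move/(smooth_atP ac' ad cx' dx): sg => [cg sg].
apply/(smooth_atP ac ad cx) => //; split; first exact: continuous_comp.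
have : Cinfty_at ((cmap d \o g \o cinv c') \o (cmap c' \o f \o cinv c)) (cmap c x).
  by apply: Cinfty_at_comp => //=; rewrite (cmapK cx).
apply: Cinfty_at_ext; apply: (near_cinv (Q := fun y =>
  cmap d (g (cinv c' (cmap c' (f y)))) = cmap d (g (f y))) cx).
have : \near x, cdom c' (f x) by apply: cf; exact: near_cdom.
by apply: filterS => y /cmapK ->.
Qed.

Lemma smooth_at_ext M N (f g : M -> N) x :
  (\near x, f x = g x) -> smooth_at f x -> smooth_at g x.
Proof.
move=> fg; have [c ac cx] := atlas_cover x.
have [c' ac' cx'] := atlas_cover (f x).
move/(smooth_atP ac ac' cx cx') => [cf sf].
have fgx := nbhs_singleton fg.
apply/(smooth_atP ac ac' cx); first by rewrite -fgx.
split.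
  rewrite /prop_for /continuous_at -fgx; apply: cvg_trans cf.
  exact: near_eq_cvg.
apply: Cinfty_at_ext sf.
apply: (near_cinv (Q := fun y => cmap c' (f y) = cmap c' (g y)) cx).
by apply: filterS fg => y ->.
Qed.

Lemma smooth_at_near M N (f : M -> N) x :
  smooth_at f x -> \near x, smooth_at f x.
Proof.
have [c ac cx] := atlas_cover x.
have [c' ac' cx'] := atlas_cover (f x).
move/(smooth_atP ac ac' cx cx') => [cf /Cinfty_at_near sf].
have cc := cmap_continuous cx.
have n1 : \near x, cdom c' (f x) by apply: cf; exact: near_cdom.
have n2 : \near x, Cinfty_at (cmap c' \o f \o cinv c) (cmap c x) by apply: cc.
have n12 : \near x, cdom c' (f x) /\ cdom c x.
  by apply: filterI n1 _; exact: near_cdom.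
have n3 : \forall y \near x, \near y, cdom c' (f y) /\ cdom c y.
  exact: near_join n12.
have n4 : \forall y \near x, Cinfty_at (cmap c' \o f \o cinv c) (cmap c y) /\
  (\near y, cdom c' (f y) /\ cdom c y) by exact: (filterI n2 n3).
apply: filterS n4 => y [sy ny].
have [c'y cy] := nbhs_singleton ny.
apply/(smooth_atP ac ac' cy c'y); split=> //.
(* [smooth_at] also asks for continuity at the nearby point [y]; it is recovered from the coordinate
   expression, which is differentiable there. *)
have h : {for y, continuous (cinv c' \o (cmap c' \o f \o cinv c) \o cmap c)}.
  apply: continuous_comp; first exact: cmap_continuous.
  apply: continuous_comp; first exact: Cinfty_at_continuous.
  by rewrite /= (cmapK cy); exact/cinv_continuous/cmap_im.
move: h; rewrite /prop_for /continuous_at /= (cmapK cy) (cmapK c'y).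
apply: cvg_trans; apply: near_eq_cvg; apply: filterS ny => z [/cmapK zc' /cmapK zc].
by rewrite /= zc zc'.
Qed.

Lemma smooth_at_id M (x : M) : smooth_at (fun y : M => y) x.
Proof.
have [c ac cx] := atlas_cover x; apply/(smooth_atP ac ac cx cx); split.
  by move=> A.
exact: Cinfty_at_transition.
Qed.

Lemma smooth_at_cst M N (y : N) (x : M) : smooth_at (fun _ : M => y) x.
Proof.
have [c ac cx] := atlas_cover x; have [c' ac' cy] := atlas_cover y.
by apply/(smooth_atP ac ac' cx cy); split; [exact: cst_continuous|
  exact: Cinfty_at_cst].
Qed.

Lemma smooth_at_pair M N1 N2 (f : M -> N1) (g : M -> N2) x :
  smooth_at f x -> smooth_at g x ->
  smooth_at (N := prod_manifold N1 N2) (fun y => (f y, g y)) x.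
Proof.
have [c ac cx] := atlas_cover x.
have [c1 ac1 c1x] := atlas_cover (f x); have [c2 ac2 c2x] := atlas_cover (g x).
move=> /(smooth_atP ac ac1 cx c1x)[cf sf] /(smooth_atP ac ac2 cx c2x)[cg sg].
apply/(@smooth_atP M (prod_manifold N1 N2) _ x c (prod_chart c1 c2)) => //.
  by exists c1, c2.
split; first exact: cvg_pair.
pose f1 := cmap c1 \o f \o cinv c; pose g1 := cmap c2 \o g \o cinv c.
apply: (Cinfty_at_eqfun (f := fun z => @row_mx0r _ (mdim N1) (mdim N2) (f1 z) +
  @row_mx0l _ (mdim N1) (mdim N2) (g1 z))).
  by move=> z; rewrite /row_mx0r /row_mx0l add_row_mx addr0 add0r.
apply: Cinfty_atD; apply: Cinfty_at_post => //.
  exact: row_mx0r_continuous.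
exact: row_mx0l_continuous.
Qed.

Lemma smooth_at_fst M N (x : prod_manifold M N) :
  smooth_at (M := prod_manifold M N) (N := M) fst x.
Proof.
have [c ac cx] := atlas_cover x.1; have [d ad dx] := atlas_cover x.2.
apply/(@smooth_atP (prod_manifold M N) M _ x (prod_chart c d) c) => //.
  by exists c, d.
split; first by case: x {cx dx} => ? ?; exact: cvg_fst.
apply: (Cinfty_at_ext (f := lsubmx)).
  apply: filterS (near_cim (c := prod_chart c d) (cmap_im _)); last by split.
  by move=> z [z1 z2]; rewrite /= cinvK.
by apply: Cinfty_at_linear; exact: continuous_lsubmx.
Qed.

Lemma smooth_at_snd M N (x : prod_manifold M N) :
  smooth_at (M := prod_manifold M N) (N := N) snd x.
Proof.
have [c ac cx] := atlas_cover x.1; have [d ad dx] := atlas_cover x.2.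
apply/(@smooth_atP (prod_manifold M N) N _ x (prod_chart c d) d) => //.
  by exists c, d.
split; first by case: x {cx dx} => ? ?; exact: cvg_snd.
apply: (Cinfty_at_ext (f := rsubmx)).
  apply: filterS (near_cim (c := prod_chart c d) (cmap_im _)); last by split.
  by move=> z [z1 z2]; rewrite /= cinvK.
by apply: Cinfty_at_linear; exact: continuous_rsubmx.
Qed.

Lemma smooth_at_on_open M N (D : set M) (f : M -> N) x : open D -> D x ->
  smooth_on D f -> smooth_at f x.
Proof.
move=> oD Dx /(_ x Dx)[h [sh hf]]; apply: smooth_at_ext sh.
have nD : \near x, D x by exact: open_nbhs_nbhs.
by apply: filterS (filterI hf nD) => y [+ Dy] => /(_ Dy) ->.
Qed.

End smooth_at_theory.

(** * Euclidean space as a manifold; smoothness of charts and of real functions *)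

Section euclidean.
Variables (R : realType) (n : nat).

Definition eucl_chart : chart R 'rV[R]_n n :=
  @Chart R 'rV[R]_n n setT setT id id openT openT
    (fun _ _ => I) (fun _ _ => I) (fun _ _ => erefl) (fun _ _ => erefl)
    (fun x _ => cvg_id) (fun x _ => cvg_id).

Lemma eucl_cover (x : 'rV[R]_n) : exists2 c, [set eucl_chart] c & cdom c x.
Proof. by exists eucl_chart. Qed.

Lemma eucl_compat c c' : [set eucl_chart] c -> [set eucl_chart] c' ->
  Cinfty (cim c `&` cinv c @^-1` cdom c') (cmap c' \o cinv c).
Proof.
move=> -> -> k; apply: (@Ck_linear _ _ _ _ _ idfun).
by move=> x; exact: cvg_id.
Qed.

(** Turns charts, their inverses and curves in coordinates into maps of manifolds, to which
    [smooth_at_comp] applies. *)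
Definition eucl : manifold R := Manifold eucl_cover eucl_compat.

End euclidean.

Section charts_smooth.
Context {R : realType}.
Implicit Types M N L : manifold R.

Lemma smooth_at_cmap M (c : chart R M (mdim M)) x : atlas c -> cdom c x ->
  smooth_at (N := eucl R (mdim M)) (cmap c) x.
Proof.
move=> ac cx; apply/(@smooth_atP _ _ (eucl R (mdim M)) _ _ c (eucl_chart R _)) => //.
split; first exact: cmap_continuous.
exact: Cinfty_at_transition.
Qed.

Lemma smooth_at_cinv M (c : chart R M (mdim M)) z : atlas c -> cim c z ->
  smooth_at (M := eucl R (mdim M)) (cinv c) z.
Proof.
move=> ac cz; have dz := cinv_dom cz.
apply/(@smooth_atP _ (eucl R (mdim M)) M _ _ (eucl_chart R _) c) => //.
split; first exact: cinv_continuous.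
by have := Cinfty_at_transition ac ac dz dz; rewrite (cinvK cz).
Qed.

(** The chart of the line identifies [R] with rows of length 1 by maps that are linear and
    continuous in both directions, so composing with them preserves smoothness. *)
Lemma smooth_fun_atP M (f : M -> R) x c : atlas c -> cdom c x ->
  smooth_fun_at f x <-> {for x, continuous f} /\
    Cinfty_at (f \o cinv c : 'rV[R]_(mdim M) -> R^o) (cmap c x).
Proof.
move=> ac cx.
have clin : linear (fun t : R^o => const_mx t : 'rV[R]_1).
  by move=> a u v; apply/matrixP => i j; rewrite !mxE.
pose L : {linear R^o -> 'rV[R]_1} := HB.pack (fun t : R^o => const_mx t : 'rV[R]_1)
  (GRing.isLinear.Build _ _ _ _ _ clin).
have elin : linear (fun z : 'rV[R]_1 => z ord0 ord0 : R^o).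
  by move=> a u v; rewrite !mxE.
pose E : {linear 'rV[R]_1 -> R^o} := HB.pack (fun z : 'rV[R]_1 => z ord0 ord0 : R^o)
  (GRing.isLinear.Build _ _ _ _ _ elin).
have sP := @smooth_atP _ M (line R) f x c (line_chart R) ac erefl cx I.
split=> [/sP[cf sf]|[cf sf]].
  split => //.
  have := @Cinfty_at_post _ _ _ _ _ E _ (@entry_continuous R) sf.
  by apply: Cinfty_at_eqfun => z; rewrite /= mxE.
apply/sP; split => //.
exact: (@Cinfty_at_post _ _ _ _ _ L _ (@const_mx_continuous R) sf).
Qed.

Lemma smooth_fun_at_ext M (f g : M -> R) x :
  (\near x, f x = g x) -> smooth_fun_at f x -> smooth_fun_at g x.
Proof. exact: (@smooth_at_ext _ M (line R)). Qed.

Lemma smooth_fun_at_eqfun M (f g : M -> R) x :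
  f =1 g -> smooth_fun_at f x -> smooth_fun_at g x.
Proof. by move=> /funext ->. Qed.

Lemma smooth_fun_atD M (f g : M -> R) x : smooth_fun_at f x ->
  smooth_fun_at g x -> smooth_fun_at (fun y => f y + g y) x.
Proof.
have [c ac cx] := atlas_cover x.
move=> /(smooth_fun_atP _ ac cx)[cf sf] /(smooth_fun_atP _ ac cx)[cg sg].
apply/(smooth_fun_atP _ ac cx); split; last exact: Cinfty_atD.
exact: (@continuousD _ _ _ f g).
Qed.

Lemma smooth_fun_atM M (f g : M -> R) x : smooth_fun_at f x ->
  smooth_fun_at g x -> smooth_fun_at (fun y => f y * g y) x.
Proof.
have [c ac cx] := atlas_cover x.
move=> /(smooth_fun_atP _ ac cx)[cf sf] /(smooth_fun_atP _ ac cx)[cg sg].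
apply/(smooth_fun_atP _ ac cx); split; last exact: Cinfty_atM.
exact: (@continuousM _ _ f g).
Qed.

Lemma smooth_fun_atV M (f : M -> R) x : f x != 0 -> smooth_fun_at f x ->
  smooth_fun_at (fun y => (f y)^-1) x.
Proof.
move=> f0; have [c ac cx] := atlas_cover x.
move=> /(smooth_fun_atP _ ac cx)[cf sf].
apply/(smooth_fun_atP _ ac cx); split.
  exact: (@continuousV _ _ f).
by apply: Cinfty_atV => //=; rewrite cmapK.
Qed.

Lemma smooth_fun_at_cst M (a : R) (x : M) : smooth_fun_at (fun _ => a) x.
Proof. exact: smooth_at_cst. Qed.

Lemma smooth_fun_at_sum M (I : Type) (r : seq I) (Q : pred I) (f : I -> M -> R) x :
  (forall i, Q i -> smooth_fun_at (f i) x) ->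
  smooth_fun_at (fun y => \sum_(i <- r | Q i) f i y) x.
Proof.
move=> sf; elim: r => [|i r IH].
  apply: (@smooth_fun_at_eqfun _ (fun _ => 0)); last exact: smooth_fun_at_cst.
  by move=> y; rewrite big_nil.
case: (boolP (Q i)) => Qi.
  apply: (@smooth_fun_at_eqfun _ (fun y => f i y + \sum_(i <- r | Q i) f i y)).
    by move=> y; rewrite big_cons Qi.
  by apply: smooth_fun_atD => //; exact: sf.
by apply: smooth_fun_at_eqfun IH => y; rewrite big_cons (negbTE Qi).
Qed.

Lemma smooth_fun_at_prod M (I : Type) (r : seq I) (Q : pred I) (f : I -> M -> R) x :
  (forall i, Q i -> smooth_fun_at (f i) x) ->
  smooth_fun_at (fun y => \prod_(i <- r | Q i) f i y) x.
Proof.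
move=> sf; elim: r => [|i r IH].
  apply: (@smooth_fun_at_eqfun _ (fun _ => 1)); last exact: smooth_fun_at_cst.
  by move=> y; rewrite big_nil.
case: (boolP (Q i)) => Qi.
  apply: (@smooth_fun_at_eqfun _ (fun y => f i y * \prod_(i <- r | Q i) f i y)).
    by move=> y; rewrite big_cons Qi.
  by apply: smooth_fun_atM => //; exact: sf.
by apply: smooth_fun_at_eqfun IH => y; rewrite big_cons (negbTE Qi).
Qed.

Lemma smooth_fun_at_det M n (A : M -> 'M[R]_n) x :
  (forall i j, smooth_fun_at (fun y => A y i j) x) ->
  smooth_fun_at (fun y => \det (A y)) x.
Proof.
move=> sA; apply: smooth_fun_at_sum => s _.
apply: smooth_fun_atM; first exact: smooth_fun_at_cst.
by apply: smooth_fun_at_prod.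
Qed.

(** By Cramer's rule the entries of the inverse are cofactors divided by the determinant, which
    stays nonzero near [x]. This provides the smooth coefficients in [Hor_lincomb]. *)
Lemma smooth_fun_at_invmx M n (A : M -> 'M[R]_n) x : A x \in unitmx ->
  (forall i j, smooth_fun_at (fun y => A y i j) x) ->
  forall i j, smooth_fun_at (fun y => invmx (A y) i j) x.
Proof.
move=> uA sA i j.
have sd := smooth_fun_at_det sA.
have d0 : \det (A x) != 0 by rewrite -unitfE -unitmxE.
have nd : \near x, \det (A x) != 0.
  by apply: (cvgr_neq0 _ (smooth_at_continuous sd : (fun y => \det (A y)) @ x --> _)).
apply: (@smooth_fun_at_ext _ (fun y => (\det (A y))^-1 *
    ((-1) ^+ (j + i) * \det (row' j (col' i (A y)))))).
  apply: filterS nd => y dy; rewrite /invmx unitmxE unitfE dy.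
  by rewrite !mxE /cofactor.
apply: smooth_fun_atM; first exact: smooth_fun_atV.
apply: smooth_fun_atM; first exact: smooth_fun_at_cst.
apply: smooth_fun_at_det => i' j'.
by apply: smooth_fun_at_eqfun (sA (lift j i') (lift i j')) => y; rewrite !mxE.
Qed.

End charts_smooth.

(** * Tangent vectors *)

Section tangent_vectors.
Context {R : realType}.
Implicit Types M N L : manifold R.

Lemma smooth_line_differentiable (W : normedModType R) (g : R -> W) (t : R) :
  Cinfty_at (fun z : 'rV[R]_1 => g (z ord0 ord0)) (const_mx t) ->
  differentiable g t.
Proof.
move=> sg.
have clin : linear (fun t : R^o => const_mx t : 'rV[R]_1).
  by move=> a u v; apply/matrixP => i j; rewrite !mxE.
pose L : {linear R^o -> 'rV[R]_1} := HB.pack (fun t : R^o => const_mx t : 'rV[R]_1)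
  (GRing.isLinear.Build _ _ _ _ _ clin).
have dL : differentiable L t by apply: linear_differentiable; exact: const_mx_continuous.
have := differentiable_comp dL (Cinfty_at_differentiable sg).
by rewrite [_ \o _](_ : _ = g) //; apply/funext => s /=; rewrite mxE.
Qed.

Lemma smooth_fun_line_derivable (g : R -> R) (t : R) :
  smooth_fun_at (M := line R) g t -> derivable (g : R -> R^o) t 1.
Proof.
move=> /(@smooth_fun_atP _ (line R) g t (line_chart R) erefl I)[_ sg].
apply: diff_derivable; exact: smooth_line_differentiable.
Qed.

Lemma smooth_curve_differentiable n (g : R -> 'rV[R]_n) (t : R) :
  smooth_at (M := line R) (N := eucl R n) g t -> differentiable g t.
Proof.
move=> /(@smooth_atP _ (line R) (eucl R n) g t (line_chart R) (eucl_chart R n)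
  erefl erefl I I)[_ sg].
exact: smooth_line_differentiable.
Qed.

Lemma near_curve M (c : R -> M) (t : R) x (Q : M -> Prop) :
  smooth_curve_at c t -> c t = x -> (\near x, Q x) -> \forall s \near t, Q (c s).
Proof.
move=> /(@smooth_at_continuous _ (line R)) cc <- Qx; exact: (cc _ Qx).
Qed.

Lemma velocityE M (c : R -> M) t f : smooth_fun_at f (c t) ->
  velocity c t f = (f \o c)^`()%classic t.
Proof. by move=> sf; rewrite /velocity asboolT. Qed.

Lemma velocity_nonsmooth M (c : R -> M) t f : ~ smooth_fun_at f (c t) ->
  velocity c t f = 0.
Proof. by move=> sf; rewrite /velocity asboolF. Qed.

Lemma pushE M N (f : M -> N) x v h : smooth_fun_at h (f x) ->
  push f x v h = v (h \o f).
Proof. by move=> sf; rewrite /push asboolT. Qed.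

Lemma push_nonsmooth M N (f : M -> N) x v h : ~ smooth_fun_at h (f x) ->
  push f x v h = 0.
Proof. by move=> sf; rewrite /push asboolF. Qed.

Lemma smooth_fun_at_comp M N (f : M -> N) h x : smooth_at f x ->
  smooth_fun_at h (f x) -> smooth_fun_at (h \o f) x.
Proof. exact: (@smooth_at_comp _ M N (line R)). Qed.

Lemma push_velocity M N (f : M -> N) (c : R -> M) t x : c t = x ->
  smooth_at f x -> push f x (velocity c t) = velocity (f \o c) t.
Proof.
move=> <- sf; apply/funext => h.
case: (pselect (smooth_fun_at h (f (c t)))) => sh.
  rewrite pushE // !velocityE //; exact: smooth_fun_at_comp.
by rewrite push_nonsmooth // velocity_nonsmooth.
Qed.

Lemma velocity_ext M (c c' : R -> M) t :
  (\near t, c t = c' t) -> velocity c t = velocity c' t.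
Proof.
move=> cc'; apply/funext => f.
rewrite /velocity (nbhs_singleton cc'); case: ifP => // _.
rewrite !derive1E; apply: near_eq_derive.
by apply: filterS cc' => s /= ->.
Qed.

Lemma velocity_cst M (x : M) t : velocity (fun _ => x) t = 0.
Proof.
apply/funext => f; rewrite /velocity; case: ifP => // _.
by rewrite [_ \o _](_ : _ = cst (f x)) // derive1_cst.
Qed.

Lemma tangent_velocity M (c : R -> M) x : smooth_curve_at c 0 -> c 0 = x ->
  tangent x (velocity c 0).
Proof. by move=> sc cx; exists c. Qed.

Lemma tangent_push M N (f : M -> N) x v : smooth_at f x -> tangent x v ->
  tangent (f x) (push f x v).
Proof.
move=> sf [c [sc cx ->]]; exists (f \o c); split.
- by apply: (@smooth_at_comp _ (line R)) => //; rewrite cx.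
- by rewrite /= cx.
- exact: push_velocity.
Qed.

Lemma tangent_nonsmooth M (x : M) v f : tangent x v -> ~ smooth_fun_at f x ->
  v f = 0.
Proof. by move=> [c [_ <- ->]]; exact: velocity_nonsmooth. Qed.

Lemma tangent_germ M (x : M) v f g : tangent x v -> (\near x, f x = g x) ->
  v f = v g.
Proof.
move=> tv fg; case: (pselect (smooth_fun_at f x)) => sf; last first.
  rewrite !(tangent_nonsmooth tv) // => sg; apply: sf.
  by apply: smooth_fun_at_ext sg; apply: filterS fg => y.
have sg := smooth_fun_at_ext fg sf.
case: tv => c [sc cx ->]; rewrite !velocityE ?cx // !derive1E.
apply: near_eq_derive.
exact: (near_curve (Q := fun y => f y = g y) sc cx).
Qed.

Lemma tangentD_fun M (x : M) v f g : tangent x v ->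
  smooth_fun_at f x -> smooth_fun_at g x ->
  v (fun y => f y + g y) = v f + v g.
Proof.
move=> [c [sc cx ->]] sf sg.
rewrite !velocityE ?cx //; last exact: smooth_fun_atD.
rewrite !derive1E; apply: (@deriveD _ _ _ (f \o c) (g \o c));
  apply: smooth_fun_line_derivable;
  by apply: (@smooth_fun_at_comp (line R) M c) => //; rewrite cx.
Qed.

Lemma tangentM_fun M (x : M) v f g : tangent x v ->
  smooth_fun_at f x -> smooth_fun_at g x ->
  v (fun y => f y * g y) = f x * v g + g x * v f.
Proof.
move=> [c [sc cx ->]] sf sg.
rewrite !velocityE ?cx //; last exact: smooth_fun_atM.
rewrite !derive1E -cx.
apply: (@deriveM _ _ (f \o c) (g \o c));
  apply: smooth_fun_line_derivable;
  by apply: (@smooth_fun_at_comp (line R) M c) => //; rewrite cx.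
Qed.

Lemma tangent_cst M (x : M) v (a : R) : tangent x v -> v (fun _ => a) = 0.
Proof.
move=> [c [sc cx ->]]; rewrite velocityE; last exact: smooth_fun_at_cst.
by rewrite [_ \o _](_ : _ = cst a) // derive1_cst.
Qed.

Lemma tangent_sum M (x : M) v (I : Type) (r : seq I) (f : I -> M -> R) :
  tangent x v -> (forall i, smooth_fun_at (f i) x) ->
  v (fun y => \sum_(i <- r) f i y) = \sum_(i <- r) v (f i).
Proof.
move=> tv sf; elim: r => [|i r IH].
  rewrite big_nil -[RHS](tangent_cst 0 tv); congr (v _).
  by apply/funext => y; rewrite big_nil.
rewrite big_cons -IH -(tangentD_fun tv) //; last exact: smooth_fun_at_sum.
by congr (v _); apply/funext => y; rewrite big_cons.
Qed.

(** Stated for arbitrary operators [v], like the linearity of [push] below, because it is applied to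
    Lie brackets, whose tangency is not established. *)
Lemma push_comp M N L (f : M -> N) (g : N -> L) x v : smooth_at g (f x) ->
  push g (f x) (push f x v) = push (g \o f) x v.
Proof.
move=> sg; apply/funext => h; rewrite /push.
case: asboolP => //= sh; rewrite asboolT //.
exact: smooth_fun_at_comp.
Qed.

Lemma push_ext M N (f g : M -> N) x v : tangent x v ->
  (\near x, f x = g x) -> push f x v = push g x v.
Proof.
move=> tv fg; apply/funext => h; rewrite /push (nbhs_singleton fg).
case: asboolP => //= sh; apply: tangent_germ tv _.
by apply: filterS fg => y /= ->.
Qed.

Lemma push0 M N (f : M -> N) x : push f x 0 = 0.
Proof. by apply/funext => h; rewrite /push; case: asboolP. Qed.

Lemma pushD M N (f : M -> N) x v w : push f x (v + w) = push f x v + push f x w.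
Proof.
apply/funext => h; rewrite -[RHS]/(push f x v h + push f x w h) /push.
by case: asboolP => //; rewrite addr0.
Qed.

Lemma pushZ M N (f : M -> N) x (a : R) v : push f x (a *: v) = a *: push f x v.
Proof.
apply/funext => h; rewrite -[RHS]/(a *: push f x v h) /push.
by case: asboolP => //; rewrite scaler0.
Qed.

Lemma pushB M N (f : M -> N) x v w : push f x (v - w) = push f x v - push f x w.
Proof. by rewrite -scaleN1r pushD pushZ scaleN1r. Qed.

Lemma push_sum M N (f : M -> N) x (I : Type) (r : seq I) (v : I -> tvec M) :
  push f x (\sum_(i <- r) v i) = \sum_(i <- r) push f x (v i).
Proof.
elim: r => [|i r IH]; first by rewrite !big_nil push0.
by rewrite !big_cons pushD IH.
Qed.

Lemma derive1_affine n (g : 'rV[R]_n -> R^o) (w u : 'rV[R]_n) (t : R) :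
  differentiable g (w + t *: u) ->
  (fun s : R => g (w + s *: u))^`()%classic t = 'D_u g (w + t *: u).
Proof.
move=> dg.
have da : is_diff t (fun s : R => w + s *: u) (0 + *:%R^~ u).
  exact: is_diffD.
have dg' : is_diff (w + t *: u) g ('d g (w + t *: u)) by exact: differentiableP.
have [dc1 dc2] := is_diff_comp da dg'.
rewrite derive1E'; last exact: dc1.
rewrite -[LHS]/('d (g \o (fun s : R => w + s *: u)) t 1) dc2 deriveE //=.
by rewrite -[(0 + _) _]/(0 + 1 *: u) add0r scale1r.
Qed.

(** In the product chart the three curves are straight lines through one point with directions
    [u1 + u2], [u1] and [u2], and the differential is linear in the direction. *)
Lemma derive1_diag (psi : R * R -> R) (t : R) :
  smooth_fun_at (M := prod_manifold (line R) (line R)) psi (t, t) ->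
  (fun s => psi (s, s))^`()%classic t =
  (fun s => psi (s, t))^`()%classic t + (fun s => psi (t, s))^`()%classic t.
Proof.
pose e := prod_chart (line_chart R) (line_chart R).
have ae : atlas (m := prod_manifold (line R) (line R)) e.
  by exists (line_chart R), (line_chart R).
move=> /(@smooth_fun_atP _ (prod_manifold (line R) (line R)) psi (t, t) e ae)[//|_].
move=> /Cinfty_at_differentiable dpsi.
pose phi := psi \o cinv e; pose u1 := row_mx (const_mx 1) 0 : 'rV[R]_(1 + 1).
pose u2 := row_mx 0 (const_mx 1) : 'rV[R]_(1 + 1).
have phiE a b : psi (a, b) = phi (a *: u1 + b *: u2).
  rewrite /phi /u1 /u2 !scale_row_mx !scaler0 add_row_mx addr0 add0r /=.
  by rewrite row_mxKl row_mxKr !mxE !mulr1.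
have zE : cmap e (t, t) = t *: u1 + t *: u2.
  rewrite /u1 /u2 !scale_row_mx !scaler0 add_row_mx addr0 add0r /=.
  by congr row_mx; apply/matrixP => i j; rewrite !mxE mulr1.
rewrite zE in dpsi.
have -> : (fun s => psi (s, s)) = fun s => phi (0 + s *: (u1 + u2)).
  by apply/funext => s; rewrite phiE add0r scalerDr.
have -> : (fun s => psi (s, t)) = fun s => phi (t *: u2 + s *: u1).
  by apply/funext => s; rewrite phiE addrC.
have -> : (fun s => psi (t, s)) = fun s => phi (t *: u1 + s *: u2).
  by apply/funext => s; rewrite phiE.
rewrite !derive1_affine; [|by []|by rewrite addrC|by rewrite add0r scalerDr].
rewrite add0r scalerDr [t *: u2 + _]addrC.
by rewrite !deriveE // linearD.
Qed.

(** Reduces to [derive1_diag] by giving the two curves independent times: the function of [(s, s')]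
    is [f] applied to [F (c1 s, c2 s')]. *)
Lemma velocity_pair M N L (F : prod_manifold M N -> L) (c1 : R -> M) (c2 : R -> N) t :
  smooth_curve_at c1 t -> smooth_curve_at c2 t ->
  smooth_at F (c1 t, c2 t) ->
  velocity (fun s => F (c1 s, c2 s)) t =
  velocity (fun s => F (c1 s, c2 t)) t + velocity (fun s => F (c1 t, c2 s)) t.
Proof.
move=> s1 s2 sF; apply/funext => f.
rewrite -[RHS]/(velocity (fun s => F (c1 s, c2 t)) t f +
  velocity (fun s => F (c1 t, c2 s)) t f).
case: (pselect (smooth_fun_at f (F (c1 t, c2 t)))) => sf; last first.
  by rewrite !velocity_nonsmooth // addr0.
rewrite !velocityE //.
pose LL := prod_manifold (line R) (line R).
apply: (@derive1_diag (fun p => f (F (c1 p.1, c2 p.2)))).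
apply: (@smooth_fun_at_comp LL L (fun p => F (c1 p.1, c2 p.2))) => //.
apply: (@smooth_at_comp _ LL (prod_manifold M N) L (fun p => (c1 p.1, c2 p.2))) => //.
apply: smooth_at_pair.
  by apply: (@smooth_at_comp _ LL (line R) M fst) => //; exact: smooth_at_fst.
by apply: (@smooth_at_comp _ LL (line R) N snd) => //; exact: smooth_at_snd.
Qed.

(** A sum of velocities must itself be the velocity of a curve. In a chart, [F] adds positions
    relative to [x], so that [F (y, x) = y] and [F (x, y) = y]; [velocity_pair] applied to [F] then
    yields the sum of the two velocities. *)
Lemma tangentD M (x : M) v w : tangent x v -> tangent x w -> tangent x (v + w).
Proof.
move=> [c1 [s1 c1x ->]] [c2 [s2 c2x ->]].
have [c ac cx] := atlas_cover x; set n := mdim M in c ac cx *.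
pose A (p : prod_manifold (eucl R n) (eucl R n)) : eucl R n := p.1 + p.2 - cmap c x.
have sA p : smooth_at A p.
  pose e := prod_chart (eucl_chart R n) (eucl_chart R n).
  apply/(@smooth_atP _ (prod_manifold (eucl R n) (eucl R n)) (eucl R n) A p e
    (eucl_chart R n)) => //.
    by exists (eucl_chart R n), (eucl_chart R n).
  split.
    apply: continuousB; last exact: cst_continuous.
    by apply: continuousD; case: p => ? ?; [exact: cvg_fst|exact: cvg_snd].
  apply: (Cinfty_at_eqfun (f := fun z => (lsubmx z + rsubmx z) + cst (- cmap c x) z)) => //.
  apply: Cinfty_atD; last exact: Cinfty_at_cst.
  apply: Cinfty_atD; apply: Cinfty_at_linear.
    exact: continuous_lsubmx.
  exact: continuous_rsubmx.
pose MM := prod_manifold M M.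
pose F (p : MM) : M := cinv c (A (cmap c p.1, cmap c p.2)).
have Fl y : cdom c y -> F (y, x) = y by move=> cy; rewrite /F /A /= addrK cmapK.
have Fr y : cdom c y -> F (x, y) = y by move=> cy; rewrite /F /A /= addrAC subrr add0r cmapK.
have sF : smooth_at F (x, x).
  apply: (@smooth_at_comp _ MM (eucl R n) M).
    apply: (@smooth_at_comp _ MM (prod_manifold (eucl R n) (eucl R n)) (eucl R n)) => //.
    apply: smooth_at_pair.
      apply: (@smooth_at_comp _ MM M (eucl R n) fst); first exact: smooth_at_fst.
      exact: smooth_at_cmap.
    apply: (@smooth_at_comp _ MM M (eucl R n) snd); first exact: smooth_at_snd.
    exact: smooth_at_cmap.
  by apply: smooth_at_cinv => //; rewrite /A /= addrK; exact: cmap_im.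
exists (fun s => F (c1 s, c2 s)); split.
- apply: (@smooth_at_comp _ (line R) MM M (fun s => (c1 s, c2 s))).
    exact: smooth_at_pair.
  by rewrite c1x c2x.
- by rewrite c1x c2x Fl.
- rewrite velocity_pair //; last by rewrite c1x c2x.
  rewrite c1x c2x; congr (_ + _); apply: velocity_ext.
    have : \forall s \near 0, cdom c (c1 s).
      exact: near_curve s1 c1x (near_cdom cx).
    by apply: filterS => s /Fl ->.
  have : \forall s \near 0, cdom c (c2 s).
    exact: near_curve s2 c2x (near_cdom cx).
  by apply: filterS => s /Fr ->.
Qed.

Lemma tangentZ M (x : M) (a : R) v : tangent x v -> tangent x (a *: v).
Proof.
move=> [c [sc cx ->]].
have sa : smooth_fun_at (M := line R) (fun s : R => a * s) 0.
  apply: smooth_fun_atM; first exact: smooth_fun_at_cst.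
  exact: (@smooth_at_id _ (line R)).
exists (fun s => c (a * s)); split.
- by apply: (@smooth_at_comp _ (line R) (line R) M (fun s : R => a * s)) => //; rewrite mulr0.
- by rewrite mulr0.
- apply/funext => f; rewrite -[LHS]/(a * velocity c 0 f).
  case: (pselect (smooth_fun_at f x)) => sf; last first.
    by rewrite !velocity_nonsmooth ?mulr0 ?cx.
  rewrite !velocityE ?mulr0 ?cx //.
  have sfc : smooth_fun_at (M := line R) (f \o c) 0.
    by apply: smooth_fun_at_comp => //; rewrite cx.
  have := @derive1_comp R (fun s : R => a * s) (f \o c) 0.
  rewrite mulr0 => H; rewrite [RHS]H.
  - rewrite derive1Ml; last exact: derivable_id.
    by rewrite derive1_id mulr1 mulrC.
  - exact: smooth_fun_line_derivable.
  - exact: smooth_fun_line_derivable.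
Qed.

Lemma tangent0 M (x : M) : tangent x 0.
Proof. by exists (fun _ => x); split; [exact: smooth_at_cst| |rewrite velocity_cst]. Qed.

Lemma tangentN M (x : M) v : tangent x v -> tangent x (- v).
Proof. by rewrite -scaleN1r; exact: tangentZ. Qed.

Lemma tangentB M (x : M) v w : tangent x v -> tangent x w -> tangent x (v - w).
Proof. by move=> tv /tangentN; exact: tangentD. Qed.

Lemma tangent_lincomb M (x : M) (I : Type) (r : seq I) (a : I -> R) (v : I -> tvec M) :
  (forall i, tangent x (v i)) -> tangent x (\sum_(i <- r) a i *: v i).
Proof.
move=> tv; elim: r => [|i r IH]; first by rewrite big_nil; exact: tangent0.
by rewrite big_cons; apply: tangentD => //; exact: tangentZ.
Qed.

Definition coordinate M (c : chart R M (mdim M)) (j : 'I_(mdim M)) (y : M) : R :=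
  cmap c y ord0 j.

Lemma smooth_fun_at_coordinate M (c : chart R M (mdim M)) x j :
  atlas c -> cdom c x -> smooth_fun_at (coordinate c j) x.
Proof.
move=> ac cx; apply/(smooth_fun_atP _ ac cx); split.
  apply: (@continuous_comp _ _ _ (cmap c) (fun z : 'rV[R]_(mdim M) => z ord0 j)).
    exact: cmap_continuous.
  exact: coord_continuous.
apply: (Cinfty_at_entry (f := cmap c \o cinv c)).
exact: Cinfty_at_transition.
Qed.

Lemma tangent_chart M (c : chart R M (mdim M)) x v f : atlas c -> cdom c x ->
  tangent x v -> smooth_fun_at f x ->
  v f = \sum_j v (coordinate c j) * 'D_(delta_mx ord0 j) (f \o cinv c) (cmap c x).
Proof.
move=> ac cx [g [sg gx ->]] sf.
have /(smooth_fun_atP _ ac cx)[_ sf'] := sf.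
have sh : smooth_at (M := line R) (N := eucl R (mdim M)) (cmap c \o g) 0.
  by apply: (@smooth_at_comp _ (line R) M (eucl R (mdim M))) => //; rewrite gx;
    exact: smooth_at_cmap.
have dh := smooth_curve_differentiable sh.
rewrite velocityE ?gx // derive1E.
have -> : 'D_1 (f \o g) 0 = 'D_1 ((f \o cinv c) \o (cmap c \o g)) 0.
  apply: near_eq_derive.
  have : \forall s \near 0, cdom c (g s).
    exact: near_curve sg gx (near_cdom cx).
  by apply: filterS => s gs /=; rewrite cmapK.
rewrite derive_comp //; last by rewrite /= gx; exact: Cinfty_at_differentiable.
rewrite /= gx; apply: eq_bigr => j _; congr (_ * _).
rewrite derive_mx; last exact: diff_derivable.
rewrite mxE velocityE ?gx ?derive1E //; exact: smooth_fun_at_coordinate.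
Qed.

Lemma tangent_eq M (c : chart R M (mdim M)) x v w : atlas c -> cdom c x ->
  tangent x v -> tangent x w ->
  (forall j, v (coordinate c j) = w (coordinate c j)) -> v = w.
Proof.
move=> ac cx tv tw vw; apply/funext => f.
case: (pselect (smooth_fun_at f x)) => sf; last first.
  by rewrite !(tangent_nonsmooth _ sf).
rewrite !(tangent_chart ac cx _ sf) //.
by apply: eq_bigr => j _; rewrite vw.
Qed.

(** The extension has constant coefficients in a chart, those of [v]: its value at [y] is the
    velocity of a straight line. It shows that the set defining the curvature is not empty. *)
Lemma tangent_extension M (x : M) v : tangent x v ->
  exists U X, [/\ open_nbhs x U, smooth_vector_field U X & X x = v].
Proof.
move=> tv; have [c ac cx] := atlas_cover x.
pose u : 'rV[R]_(mdim M) := \row_j v (coordinate c j).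
pose X (y : M) : tvec M := velocity (fun s => cinv c (cmap c y + s *: u)) 0.
have tX y : cdom c y -> tangent y (X y).
  move=> cy; apply: tangent_velocity; last by rewrite scale0r addr0 cmapK.
  apply: (@smooth_at_comp _ (line R) (eucl R (mdim M)) M (fun s => cmap c y + s *: u)).
    apply/(@smooth_atP _ (line R) (eucl R (mdim M)) _ 0 (line_chart R)
      (eucl_chart R (mdim M))) => //.
    split.
      have cs : continuous (fun s : R => cmap c y + s *: u).
        by move=> s; apply: cvgD; [exact: cvg_cst|exact: scalel_continuous].
      exact: cs.
    apply: (Cinfty_at_eqfun (f := fun z : 'rV[R]_1 => cst (cmap c y) z + z ord0 ord0 *: u)) => //.
    apply: Cinfty_atD; first exact: Cinfty_at_cst.
    apply: Cinfty_at_scalel; apply: (Cinfty_at_entry (f := idfun)).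
    apply: Cinfty_at_linear => z; exact: cvg_id.
  by apply: smooth_at_cinv; rewrite // scale0r addr0; exact: cmap_im.
have XE y f : cdom c y -> smooth_fun_at f y ->
    X y f = 'D_u (f \o cinv c) (cmap c y).
  move=> cy sf; have /(smooth_fun_atP _ ac cy)[_ sf'] := sf.
  rewrite /X velocityE; last by rewrite scale0r addr0 cmapK.
  rewrite (@derive1_affine _ (f \o cinv c)); last first.
    by rewrite scale0r addr0; exact: Cinfty_at_differentiable.
  by rewrite scale0r addr0.
exists (cdom c), X; split; first by split => //; exact: open_cdom.
  move=> y cy; split; first exact: tX.
  move=> f sf.
  apply: (@smooth_fun_at_ext _ _ (fun y => 'D_u (f \o cinv c) (cmap c y))).
    have ny : \forall z \near y, cdom c z /\ smooth_fun_at f z.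
      apply: filterI; first exact: near_cdom.
      exact: (@smooth_at_near _ M (line R) f y sf).
    by apply: filterS ny => z [cz sz]; rewrite XE.
  apply: (@smooth_fun_at_comp M (eucl R (mdim M)) (cmap c)
      (fun z => 'D_u (f \o cinv c) z) y).
    exact: smooth_at_cmap.
  have /(smooth_fun_atP _ ac cy)[_ /(Cinfty_at_derive u) sf'] := sf.
  apply/(@smooth_fun_atP _ (eucl R (mdim M)) _ _ (eucl_chart R (mdim M))) => //.
  by split => //; exact: Cinfty_at_continuous.
apply: (tangent_eq ac cx) => //; first exact: tX.
move=> j; have sj := smooth_fun_at_coordinate j ac cx.
rewrite XE // (tangent_chart ac cx tv sj).
have /(smooth_fun_atP _ ac cx)[_ sj'] := sj.
have dj := Cinfty_at_differentiable sj'.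
rewrite (deriveE _ dj) [X in _ X = _]row_sum_delta linear_sum.
by apply: eq_bigr => i _; rewrite linearZ mxE (deriveE _ dj).
Qed.

End tangent_vectors.

(** * Frames and Lie brackets *)

Section frames.
Context {R : realType}.
Implicit Types M N : manifold R.

(** Germ version of [smooth_vector_field]: smoothness is required at [x] alone, which is all that a
    bracket at [x] uses. *)
Definition smooth_field_at M (X : M -> tvec M) (x : M) : Prop :=
  (\forall y \near x, tangent y (X y)) /\
  forall f, smooth_fun_at f x -> smooth_fun_at (fun y => X y f) x.

Lemma smooth_vector_field_at M (U : set M) X x : open_nbhs x U ->
  smooth_vector_field U X -> smooth_field_at X x.
Proof.
move=> [oU Ux] sX; split; last by have [_] := sX x Ux.
by apply: filterS (open_nbhs_nbhs (conj oU Ux)) => y /sX[].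
Qed.

Lemma smooth_field_at_tangent M (X : M -> tvec M) x :
  smooth_field_at X x -> tangent x (X x).
Proof. by move=> [/nbhs_singleton]. Qed.

Lemma lincombE M (I : Type) (r : seq I) (a : I -> R) (v : I -> tvec M) h :
  (\sum_(i <- r) a i *: v i) h = \sum_(i <- r) a i * v i h.
Proof.
elim: r => [|i r IH]; first by rewrite !big_nil.
by rewrite !big_cons -IH.
Qed.

Lemma lie_bracketE M (X Y : M -> tvec M) x f : smooth_fun_at f x ->
  lie_bracket X Y x f = X x (fun y => Y y f) - Y x (fun y => X y f).
Proof. by move=> sf; rewrite /lie_bracket asboolT. Qed.

Lemma lie_bracket_nonsmooth M (X Y : M -> tvec M) x f : ~ smooth_fun_at f x ->
  lie_bracket X Y x f = 0.
Proof. by move=> sf; rewrite /lie_bracket asboolF. Qed.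

Lemma near_smooth_fun M (x : M) f : smooth_fun_at f x -> \near x, smooth_fun_at f x.
Proof. exact: (@smooth_at_near _ M (line R)). Qed.

Section lincomb.
Variables (M : manifold R) (x : M) (k : nat) (Z : 'I_k -> M -> tvec M).
Hypothesis sZ : forall i, smooth_field_at (Z i) x.

Lemma derive_lincomb (v : tvec M) (g : 'I_k -> M -> R) (Y : M -> tvec M) h :
  tangent x v -> (forall i, smooth_fun_at (g i) x) ->
  (\near x, Y x = \sum_i g i x *: Z i x) -> smooth_fun_at h x ->
  v (fun y => Y y h) =
  \sum_j (g j x * v (fun y => Z j y h) + Z j x h * v (g j)).
Proof.
move=> tv sg YE sh.
rewrite (tangent_germ (g := fun y => \sum_j g j y * Z j y h) tv); last first.
  by apply: filterS YE => y ->; rewrite lincombE.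
rewrite (tangent_sum _ tv) => [|i]; last first.
  by apply: smooth_fun_atM => //; have [_] := sZ i; exact.
apply: eq_bigr => j _; rewrite (tangentM_fun tv) //.
by have [_] := sZ j; exact.
Qed.

(** The Leibniz rule separates the derivatives of the coefficients, which multiply the [Z j] only,
    from a part that depends on the values of the coefficients at [x]. For a frame of [H] the first
    part is horizontal, so modulo [H] the bracket depends on [X x] and [Y x] only. *)
Lemma lie_bracket_lincomb (f g : 'I_k -> M -> R) (X Y : M -> tvec M) :
  (forall i, smooth_fun_at (f i) x) -> (forall i, smooth_fun_at (g i) x) ->
  (\near x, X x = \sum_i f i x *: Z i x) ->
  (\near x, Y x = \sum_i g i x *: Z i x) ->
  lie_bracket X Y x = \sum_j (X x (g j) - Y x (f j)) *: Z j x +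
    \sum_i f i x *: \sum_j g j x *: lie_bracket (Z i) (Z j) x.
Proof.
move=> sf sg XE YE; apply/funext => h.
have tZ i := smooth_field_at_tangent (sZ i).
have tX : tangent x (X x) by rewrite (nbhs_singleton XE); exact: tangent_lincomb.
have tY : tangent x (Y x) by rewrite (nbhs_singleton YE); exact: tangent_lincomb.
rewrite -[RHS]/((\sum_j (X x (g j) - Y x (f j)) *: Z j x) h +
  (\sum_i f i x *: \sum_j g j x *: lie_bracket (Z i) (Z j) x) h).
rewrite !lincombE; under [X in _ = _ + X]eq_bigr do rewrite lincombE.
case: (pselect (smooth_fun_at h x)) => sh; last first.
  rewrite lie_bracket_nonsmooth // !big1 ?addr0 // => i _.
    rewrite big1 ?mulr0 // => j _.
    by rewrite lie_bracket_nonsmooth // mulr0.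
  by rewrite (tangent_nonsmooth (tZ i)) // mulr0.
rewrite lie_bracketE // (derive_lincomb tX sg YE sh) (derive_lincomb tY sf XE sh).
rewrite !big_split /=.
have XZ j : X x (fun y => Z j y h) = \sum_i f i x * Z i x (fun y => Z j y h).
  by rewrite {1}(nbhs_singleton XE) lincombE.
have YZ j : Y x (fun y => Z j y h) = \sum_i g i x * Z i x (fun y => Z j y h).
  by rewrite {1}(nbhs_singleton YE) lincombE.
have -> : \sum_j (X x (g j) - Y x (f j)) * Z j x h =
    \sum_j Z j x h * X x (g j) - \sum_j Z j x h * Y x (f j).
  rewrite -sumrB; apply: eq_bigr => j _.
  by rewrite mulrBl; congr (_ - _); exact: mulrC.
have -> : \sum_i f i x * \sum_j g j x * lie_bracket (Z i) (Z j) x h =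
    \sum_j g j x * X x (fun y => Z j y h) - \sum_j f j x * Y x (fun y => Z j y h).
  under [X in _ = X - _]eq_bigr do rewrite XZ mulr_sumr.
  under [X in _ = _ - X]eq_bigr do rewrite YZ mulr_sumr.
  rewrite [X in _ = X - _]exchange_big /= -sumrB; apply: eq_bigr => i _.
  rewrite mulr_sumr -sumrB; apply: eq_bigr => j _.
  by rewrite lie_bracketE // !mulrBr [g j x * (f i x * _)]mulrCA.
by rewrite opprD addrACA addrC.
Qed.

End lincomb.

(** Replaces [tangent_germ] for brackets. Since the inner field is evaluated at points near [x], the
    equality of [f] and [g] is needed near each of those points, which [near_join] provides. *)
Lemma lie_bracket_germ M (X Y : M -> tvec M) x f g :
  smooth_field_at X x -> smooth_field_at Y x ->
  (\near x, f x = g x) -> lie_bracket X Y x f = lie_bracket X Y x g.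
Proof.
move=> sX sY fg; case: (pselect (smooth_fun_at f x)) => sf; last first.
  rewrite !lie_bracket_nonsmooth // => sg; apply: sf.
  by apply: smooth_fun_at_ext sg; apply: filterS fg => y.
have fgn : \forall y \near x, \near y, f y = g y by exact: near_join fg.
rewrite !lie_bracketE //; last exact: smooth_fun_at_ext sf.
congr (_ - _); apply: tangent_germ; try exact: smooth_field_at_tangent.
  have [tY _] := sY; near=> y; apply: (@tangent_germ _ _ y).
    by near: y.
  by near: y.
have [tX _] := sX; near=> y; apply: (@tangent_germ _ _ y).
  by near: y.
by near: y.
Unshelve. all: by end_near. Qed.

Definition frame_at M (H : M -> set (tvec M)) (x : M) k (Z : 'I_k -> M -> tvec M) :=
  (forall i, smooth_field_at (Z i) x) /\
  \forall y \near x, H y = [set \sum_i a i *: Z i y | a in [set: 'I_k -> R]] /\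
    forall a : 'I_k -> R, \sum_i a i *: Z i y = 0 -> forall i, a i = 0.

Lemma subbundle_frame M (H : M -> set (tvec M)) x : subbundle H ->
  exists k (Z : 'I_k -> M -> tvec M), frame_at H x Z.
Proof.
move=> /(_ x)[U [k [Z [oU sZ iZ HZ]]]]; exists k, Z; split.
  by move=> i; exact: smooth_vector_field_at oU (sZ i).
apply: filterS (open_nbhs_nbhs oU) => y Uy; split; first exact: HZ.
by move=> a; exact: iZ.
Qed.

Lemma frame_coefs_inj M k (v : 'I_k -> tvec M) :
  (forall a : 'I_k -> R, \sum_i a i *: v i = 0 -> forall i, a i = 0) ->
  forall a b : 'I_k -> R, \sum_i a i *: v i = \sum_i b i *: v i -> a =1 b.
Proof.
move=> iv a b ab i; apply/eqP; rewrite -subr_eq0; apply/eqP.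
apply: (iv (fun i => a i - b i)).
rewrite (eq_bigr (fun i => a i *: v i - b i *: v i)).
  by rewrite sumrB ab subrr.
by move=> j _; rewrite scalerBl.
Qed.

Section subbundle_fibres.
Variables (M : manifold R) (H : M -> set (tvec M)).
Hypothesis sH : subbundle H.

Lemma subbundle_tangent x v : H x v -> tangent x v.
Proof.
have [k [Z [sZ nZ]]] := subbundle_frame x sH.
have [HZ _] := nbhs_singleton nZ.
rewrite HZ => -[a _ <-]; apply: tangent_lincomb => i.
exact: smooth_field_at_tangent.
Qed.

Lemma subbundleD x v w : H x v -> H x w -> H x (v + w).
Proof.
have [k [Z [sZ nZ]]] := subbundle_frame x sH.
have [HZ _] := nbhs_singleton nZ.
rewrite HZ => -[a _ <-] [b _ <-]; exists (fun i => a i + b i) => //.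
by rewrite -big_split; apply: eq_bigr => i _; rewrite scalerDl.
Qed.

Lemma subbundleZ x (a : R) v : H x v -> H x (a *: v).
Proof.
have [k [Z [sZ nZ]]] := subbundle_frame x sH.
have [HZ _] := nbhs_singleton nZ.
rewrite HZ => -[b _ <-]; exists (fun i => a * b i) => //.
by rewrite scaler_sumr; apply: eq_bigr => i _; rewrite scalerA.
Qed.

Lemma subbundleB x v w : H x v -> H x w -> H x (v - w).
Proof. by move=> Hv Hw; apply: subbundleD => //; rewrite -scaleN1r; exact: subbundleZ. Qed.

End subbundle_fibres.

(** * Images of vector fields and brackets under a local diffeomorphism *)

Section push_field.
Variables (M N : manifold R) (F : M -> N) (F' : N -> M) (x : M).
Hypotheses (sF : smooth_at F x) (sF' : smooth_at F' (F x)).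
Hypotheses (FK : \near x, F' (F x) = x) (F'K : \forall z \near F x, F (F' z) = z).

(** The image of [X] under [F], meaningful only near [F x], where [F'] is inverse to [F]. *)
Definition push_field (X : M -> tvec M) (z : N) : tvec N :=
  push F (F' z) (X (F' z)).

Let FKx : F' (F x) = x. Proof. exact: nbhs_singleton FK. Qed.

Lemma near_local_inverse (Q : M -> Prop) :
  (\near x, Q x) -> \forall z \near F x, Q (F' z).
Proof. by move=> Qx; apply: (smooth_at_continuous sF'); rewrite /= FKx. Qed.

Lemma push_fieldE X h : smooth_fun_at h (F x) ->
  \forall z \near F x, push_field X z h = X (F' z) (h \o F).
Proof.
move=> /near_smooth_fun nh; near=> z.
rewrite /push_field pushE // (_ : F (F' z) = z); near: z => //.
Unshelve. all: by end_near. Qed.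

Lemma smooth_push_field X : smooth_field_at X x ->
  smooth_field_at (push_field X) (F x).
Proof.
move=> [tX sX]; split.
  have nX := near_local_inverse tX.
  have nF := near_local_inverse (smooth_at_near sF).
  near=> z; rewrite -[z in tangent z _](_ : F (F' z) = z); last by near: z.
  by apply: tangent_push; near: z.
move=> h sh.
apply: (@smooth_fun_at_ext _ _ (fun z => X (F' z) (h \o F))).
  by apply: filterS (push_fieldE X sh) => z ->.
apply: (@smooth_fun_at_comp _ N M F' (fun y => X y (h \o F))) => //.
rewrite FKx; apply: sX; exact: smooth_fun_at_comp.
Unshelve. all: by end_near. Qed.

Lemma push_field_at X : push_field X (F x) = push F x (X x).
Proof. by rewrite /push_field FKx. Qed.

Lemma push_field2 X Y h : smooth_field_at X x -> smooth_field_at Y x ->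
  smooth_fun_at h (F x) ->
  push_field X (F x) (fun z => push_field Y z h) = X x (fun y => Y y (h \o F)).
Proof.
move=> sX sY sh.
have sXF := smooth_field_at_tangent (smooth_push_field sX).
rewrite (tangent_germ sXF (push_fieldE Y sh)) push_field_at.
have sYh : smooth_fun_at (fun y => Y y (h \o F)) x.
  by have [_] := sY; apply; exact: smooth_fun_at_comp.
rewrite pushE.
  apply: tangent_germ; first exact: smooth_field_at_tangent.
  by apply: filterS FK => y /= ->.
by apply: (@smooth_fun_at_comp _ N M F' (fun y => Y y (h \o F))) => //; rewrite FKx.
Qed.

Lemma lie_bracket_push_field X Y : smooth_field_at X x -> smooth_field_at Y x ->
  lie_bracket (push_field X) (push_field Y) (F x) = push F x (lie_bracket X Y x).
Proof.
move=> sX sY; apply/funext => h.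
case: (pselect (smooth_fun_at h (F x))) => sh; last first.
  by rewrite lie_bracket_nonsmooth // push_nonsmooth.
rewrite lie_bracketE // !push_field2 // pushE // lie_bracketE //.
exact: smooth_fun_at_comp.
Qed.

(** The two hypotheses on [u] hold for tangent vectors and for brackets alike, and
    [Ver_push_bracket] needs the second case. *)
Lemma push_local_inverse (u : tvec M) :
  (forall f g, (\near x, f x = g x) -> u f = u g) ->
  (forall f, ~ smooth_fun_at f x -> u f = 0) ->
  push F' (F x) (push F x u) = u.
Proof.
move=> germ zero; rewrite push_comp //; apply/funext => h.
case: (pselect (smooth_fun_at h x)) => sh; last first.
  by rewrite zero // push_nonsmooth //= FKx.
rewrite pushE /= ?FKx //; apply: germ.
by apply: filterS FK => y /= ->.
Qed.

Lemma push_local_inverse_tangent (u : tvec M) : tangent x u ->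
  push F' (F x) (push F x u) = u.
Proof.
move=> tu; apply: push_local_inverse => [f g|f]; first exact: tangent_germ.
exact: tangent_nonsmooth.
Qed.

End push_field.

Section push_frame.
Variables (M N : manifold R) (F : M -> N) (F' : N -> M) (x : M).
Hypotheses (sF : smooth_at F x) (sF' : smooth_at F' (F x)).
Hypotheses (FK : \near x, F' (F x) = x) (F'K : \forall z \near F x, F (F' z) = z).

Lemma near_push_local_inverse :
  \forall y \near x, forall u, tangent y u -> push F' (F y) (push F y u) = u.
Proof.
have n1 := smooth_at_near sF.
have n2 : \forall y \near x, smooth_at F' (F y).
  exact: (smooth_at_continuous sF (smooth_at_near sF')).
have n3 : \forall y \near x, \near y, F' (F y) = y by exact: near_join FK.
near=> y => u tu; apply: push_local_inverse_tangent => //; by near: y.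
Unshelve. all: by end_near. Qed.

(** A vanishing combination of the images pushes back by [F'] to a vanishing combination of the
    [Z i], whence independence; the span is the image of [H] by hypothesis. *)
Lemma push_frame (H : M -> set (tvec M)) (H' : N -> set (tvec N)) k
    (Z : 'I_k -> M -> tvec M) :
  (\forall y \near x, H' (F y) = push F y @` H y) ->
  frame_at H x Z -> frame_at H' (F x) (fun i => push_field F F' (Z i)).
Proof.
move=> HF [sZ nZ]; split; first by move=> i; exact: smooth_push_field.
have inv := near_local_inverse sF' FK.
have tZ : \forall y \near x, forall i, tangent y (Z i y).
  by apply: filter_forall => i; have [] := sZ i.
have := inv _ near_push_local_inverse; have := inv _ tZ.
have := inv _ nZ; have := inv _ HF.
move=> n1 n2 n3 n4; near=> z.
have Hz : H' (F (F' z)) = push F (F' z) @` H (F' z) by near: z.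
have zK : F (F' z) = z by near: z.
have [HZ iZ] : H (F' z) = [set \sum_i a i *: Z i (F' z) | a in [set: 'I_k -> R]] /\
    forall a : 'I_k -> R, \sum_i a i *: Z i (F' z) = 0 -> forall i, a i = 0.
  by near: z.
have pushE a : \sum_i a i *: push_field F F' (Z i) z =
    push F (F' z) (\sum_i a i *: Z i (F' z)).
  by rewrite push_sum; apply: eq_bigr => i _; rewrite pushZ.
split.
  rewrite -[in LHS]zK Hz HZ; apply/seteqP; split=> [_ [_ [a _ <-] <-]|_ [a _ <-]].
    by exists a.
  by exists (\sum_i a i *: Z i (F' z)) => //; exists a.
move=> a; rewrite pushE => a0; apply: iZ.
have /(_ (\sum_i a i *: Z i (F' z))) <- : forall u, tangent (F' z) u ->
  push F' (F (F' z)) (push F (F' z) u) = u by near: z.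
  by rewrite a0 push0.
by apply: tangent_lincomb; near: z.
Unshelve. all: by end_near. Qed.

End push_frame.

End frames.

(** * Horizontal distributions and curvature *)

Section horizontal.
Context {R : realType} {G : lie_groupoid R} {P M : manifold R}.
Variables (B : principal_bundle G P M) (H : P -> set (tvec P)).
Hypothesis hH : horizontal_distribution B H.

Let sH : subbundle H. Proof. by case: hH. Qed.
Let smooth_proj : smooth (bproj B). Proof. by have [] := proj_bundle B. Qed.

Lemma verticalB p v w : vertical B p v -> vertical B p w -> vertical B p (v - w).
Proof.
move=> [tv v0] [tw w0]; split; first exact: tangentB.
by rewrite pushB v0 w0 subr0.
Qed.

Lemma verticalD p v w : vertical B p v -> vertical B p w -> vertical B p (v + w).
Proof.
move=> [tv v0] [tw w0]; split; first exact: tangentD.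
by rewrite pushD v0 w0 addr0.
Qed.

Lemma verticalN p v : vertical B p v -> vertical B p (- v).
Proof.
move=> [tv v0]; split; first exact: tangentN.
by rewrite -scaleN1r pushZ v0 scaler0.
Qed.

Lemma vertical0 p : vertical B p 0.
Proof. by split; [exact: tangent0|exact: push0]. Qed.

Lemma Ver_eq p v a : vertical B p a -> H p (v - a) -> Ver B H p v = a.
Proof.
move=> va Ha; apply: xget_unique => // b [vb Hb]; case: hH => _ vH _.
apply/eqP; rewrite -subr_eq0; apply/eqP; apply: (vH p); first exact: verticalB.
have -> : b - a = (v - a) - (v - b) by rewrite opprB [RHS]addrC addrA subrK.
exact: subbundleB.
Qed.

Lemma VerP p v : tangent p v -> vertical B p (Ver B H p v) /\ H p (Hor B H p v).
Proof.
case: hH => _ _ tH tv; have [a [b [va Hb vE]]] := tH p v tv.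
have Ha : H p (v - a) by rewrite vE addrAC subrr add0r.
by rewrite /Hor (Ver_eq va Ha).
Qed.

(** For an operator without a decomposition [Ver] takes its default value 0, which is vertical as
    well; this covers brackets. *)
Lemma Ver_vertical p v : vertical B p (Ver B H p v).
Proof.
rewrite /Ver; case: xgetP => [a _ []//|_]; exact: vertical0.
Qed.

(* The coordinates of M, composed with the projection, kill vertical vectors and
   separate horizontal ones: suitable combinations of them give an invertible
   matrix of smooth functions near p, whose inverse yields the coefficients. *)
Lemma Hor_lincomb (X : P -> tvec P) p k (Z : 'I_k -> P -> tvec P) :
  smooth_field_at X p -> frame_at H p Z ->
  exists f : 'I_k -> P -> R, (forall i, smooth_fun_at (f i) p) /\
    \forall y \near p, Hor B H y (X y) = \sum_i f i y *: Z i y.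
Proof.
move=> [tX sX] [sZ nZ]; have [c ac cp] := atlas_cover (bproj B p).
pose phi j := coordinate c j \o bproj B.
have sphi j : smooth_fun_at (phi j) p.
  apply: smooth_fun_at_comp; first exact: smooth_proj.
  exact: smooth_fun_at_coordinate.
pose A y : 'M[R]_(k, mdim M) := \matrix_(i, j) Z i y (phi j).
pose xphi y : 'rV[R]_(mdim M) := \row_j X y (phi j).
have [HZ iZ] := nbhs_singleton nZ.
have AE (a : 'rV[R]_k) y j : (a *m A y) ord0 j = (\sum_i a ord0 i *: Z i y) (phi j).
  by rewrite mxE lincombE; apply: eq_bigr => i _; rewrite mxE.
have rfA : row_free (A p).
  apply: inj_row_free => a aA.
  have Ha : H p (\sum_i a ord0 i *: Z i p) by rewrite HZ; exists (a ord0).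
  have ta := subbundle_tangent sH Ha.
  have tpa := tangent_push (smooth_proj p) ta.
  have va : vertical B p (\sum_i a ord0 i *: Z i p).
    split => //; apply: (tangent_eq ac cp) => //; first exact: tangent0.
    move=> j; rewrite pushE; last exact: smooth_fun_at_coordinate.
    by rewrite -AE aA mxE.
  case: hH => _ /(_ p _ va Ha) a0 _.
  by apply/rowP => i; rewrite mxE; exact: iZ.
have [C AC] := row_freeP rfA.
pose D y := A y *m C.
have sD i j : smooth_fun_at (fun y => D y i j) p.
  apply: (@smooth_fun_at_eqfun _ _ (fun y => \sum_l A y i l * C l j)).
    by move=> y; rewrite mxE.
  apply: smooth_fun_at_sum => l _; apply: smooth_fun_atM; last exact: smooth_fun_at_cst.
  apply: (@smooth_fun_at_eqfun _ _ (fun y => Z i y (phi l))).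
    by move=> y; rewrite mxE.
  by have [_] := sZ i; apply.
have uD : D p \in unitmx by rewrite /D AC unitmx1.
have nD : \forall y \near p, D y \in unitmx.
  have d0 : \det (D p) != 0 by rewrite -unitfE -unitmxE.
  have : \forall y \near p, \det (D y) != 0.
    exact: (cvgr_neq0 _ (smooth_at_continuous (smooth_fun_at_det sD) :
      (fun y => \det (D y)) @ p --> _)).
  by apply: filterS => y; rewrite unitmxE unitfE.
exists (fun i y => (xphi y *m C *m invmx (D y)) ord0 i); split=> [i|].
  apply: (@smooth_fun_at_eqfun _ _ (fun y => \sum_l (\sum_j X y (phi j) * C j l) *
      invmx (D y) l i)).
    move=> y; rewrite mxE; apply: eq_bigr => l _; rewrite mxE; congr (_ * _).
    by apply: eq_bigr => j _; rewrite mxE.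
  apply: smooth_fun_at_sum => l _; apply: smooth_fun_atM.
    apply: smooth_fun_at_sum => j _; apply: smooth_fun_atM.
      exact: sX.
    exact: smooth_fun_at_cst.
  exact: smooth_fun_at_invmx.
have nc : \forall y \near p, cdom c (bproj B y).
  exact: (smooth_at_continuous (smooth_proj p) (near_cdom cp)).
near=> y.
have [HZy _] : H y = [set \sum_i a i *: Z i y | a in [set: 'I_k -> R]] /\
    forall a : 'I_k -> R, \sum_i a i *: Z i y = 0 -> forall i, a i = 0.
  by near: y.
have tXy : tangent y (X y) by near: y.
have [vX hX] := VerP tXy.
have cy : cdom c (bproj B y) by near: y.
have uy : D y \in unitmx by near: y.
rewrite HZy in hX; case: hX => a _ aE; rewrite -aE.
apply: eq_bigr => i _; congr (_ *: _).
have -> : xphi y = (\row_i a i) *m A y.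
  apply/rowP => j; rewrite AE mxE.
  under eq_bigr do rewrite mxE.
  rewrite aE; have vj : Ver B H y (X y) (phi j) = 0.
    have : push (bproj B) y (Ver B H y (X y)) (coordinate c j) = 0.
      by have [_ ->] := vX.
    by rewrite pushE //; exact: smooth_fun_at_coordinate.
  by rewrite -[RHS]/(X y (phi j) - Ver B H y (X y) (phi j)) vj subr0.
by rewrite -[_ *m A y *m C]mulmxA -/(D y) mulmxK // mxE.
Unshelve. all: by end_near. Qed.

Lemma smooth_Hor (X : P -> tvec P) p : smooth_field_at X p ->
  smooth_field_at (fun y => Hor B H y (X y)) p.
Proof.
move=> sX; have [k [Z fZ]] := subbundle_frame p sH.
have [f [sf fE]] := Hor_lincomb sX fZ; split.
  have [tX _] := sX; apply: filterS tX => y tX.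
  by have [_ /(subbundle_tangent sH)] := VerP tX.
move=> h sh; apply: (@smooth_fun_at_ext _ _ (fun y => \sum_i f i y * Z i y h)).
  by apply: filterS fE => y ->; rewrite lincombE.
apply: smooth_fun_at_sum => i _; apply: smooth_fun_atM => //.
by case: fZ => sZ _; have [_] := sZ i; apply.
Qed.

(** * Naturality of the curvature under a local automorphism preserving the distribution *)

Section transport.
Variables (F F' : P -> P) (p : P).
Hypotheses (sF : smooth_at F p) (sF' : smooth_at F' (F p)).
Hypotheses (FK : \near p, F' (F p) = p) (F'K : \forall z \near F p, F (F' z) = z).
Hypothesis projF : \forall y \near p, bproj B (F y) = bproj B y.
Hypothesis HF : \forall y \near p, H (F y) = push F y @` H y.

Lemma vertical_push v : vertical B p v -> vertical B (F p) (push F p v).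
Proof.
move=> [tv v0]; split; first exact: tangent_push.
rewrite push_comp; last exact: smooth_proj.
by rewrite (push_ext tv projF).
Qed.

Lemma vertical_push_inv v : vertical B (F p) v -> vertical B p (push F' (F p) v).
Proof.
have FKx : F' (F p) = p := nbhs_singleton FK.
move=> [tv v0]; split; first by rewrite -[X in tangent X]FKx; exact: tangent_push.
rewrite -{1}FKx push_comp; last exact: smooth_proj.
rewrite (push_ext (g := bproj B) tv) //.
have n1 := near_local_inverse sF' FK projF.
near=> z; rewrite /= -[in RHS](_ : F (F' z) = z); last by near: z.
by apply/esym; near: z.
Unshelve. all: by end_near. Qed.

(* Whether brackets are tangent vectors (which needs the symmetry of second
   derivatives) is irrelevant here: if not, both sides vanish. *)
Lemma Ver_push_bracket (X Y : P -> tvec P) h : smooth_field_at X p ->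
  smooth_field_at Y p -> H (F p) h ->
  Ver B H (F p) (push F p (lie_bracket X Y p) + h) =
  push F p (Ver B H p (lie_bracket X Y p)).
Proof.
move=> sX sY Hh; set w := lie_bracket X Y p.
have [[a [va Ha]]|none] := pselect (exists a, vertical B p a /\ H p (w - a)).
  rewrite (Ver_eq va Ha); apply: Ver_eq; first exact: vertical_push.
  rewrite addrAC -pushB; apply: subbundleD => //.
  by rewrite (nbhs_singleton HF); exists (w - a).
rewrite {2}/Ver xgetPN; last by move=> a [va Ha]; apply: none; exists a.
rewrite push0 /Ver xgetPN // => a [va Ha]; apply: none.
exists (push F' (F p) a); split; first exact: vertical_push_inv.
have : H (F p) (push F p w + h - a - h) by exact: subbundleB.
have -> : push F p w + h - a - h = push F p w - a.
  by rewrite addrAC addrK.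
rewrite (nbhs_singleton HF) => -[b Hb bE].
have bK : push F' (F p) (push F p b) = b.
  by apply: push_local_inverse_tangent => //; exact: subbundle_tangent Hb.
rewrite bE pushB push_local_inverse // in bK; first by rewrite bK.
  by move=> f g; exact: lie_bracket_germ.
by move=> f; exact: lie_bracket_nonsmooth.
Qed.

(** The fields at [F p] are related to those at [p] only through their horizontal values at one
    point. By [lie_bracket_lincomb], in a frame and its image, the bracket at [F p] differs from the
    image of the one at [p] by a horizontal vector, which [Ver] ignores. *)
Lemma Ver_bracket_transport (X Y X' Y' : P -> tvec P) :
  smooth_field_at X p -> smooth_field_at Y p ->
  smooth_field_at X' (F p) -> smooth_field_at Y' (F p) ->
  Hor B H (F p) (X' (F p)) = push F p (Hor B H p (X p)) ->
  Hor B H (F p) (Y' (F p)) = push F p (Hor B H p (Y p)) ->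
  Ver B H (F p) (lie_bracket (fun y => Hor B H y (X' y))
                             (fun y => Hor B H y (Y' y)) (F p)) =
  push F p (Ver B H p (lie_bracket (fun y => Hor B H y (X y))
                                   (fun y => Hor B H y (Y y)) p)).
Proof.
move=> sX sY sX' sY' XE YE.
have [k [Z fZ]] := subbundle_frame p sH.
have fZ' := push_frame sF sF' FK F'K HF fZ.
have [f [sf fE]] := Hor_lincomb sX fZ; have [g [sg gE]] := Hor_lincomb sY fZ.
have [f' [sf' fE']] := Hor_lincomb sX' fZ'.
have [g' [sg' gE']] := Hor_lincomb sY' fZ'.
have [sZ' nZ'] := fZ'; have [_ iZ'] := nbhs_singleton nZ'.
have [sZ nZ] := fZ; have [HZ _] := nbhs_singleton nZ.
have pE (a : 'I_k -> R) : \sum_i a i *: push_field F F' (Z i) (F p) =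
    push F p (\sum_i a i *: Z i p).
  by rewrite push_sum; apply: eq_bigr => i _; rewrite pushZ push_field_at.
(* The coefficients are compared at the point only; away from it they may differ. *)
have ff : (fun i => f' i (F p)) =1 (fun i => f i p).
  apply: (frame_coefs_inj iZ').
  by rewrite -(nbhs_singleton fE') XE (nbhs_singleton fE) pE.
have gg : (fun i => g' i (F p)) =1 (fun i => g i p).
  apply: (frame_coefs_inj iZ').
  by rewrite -(nbhs_singleton gE') YE (nbhs_singleton gE) pE.
have hE : forall a, H p (\sum_i a i *: Z i p).
  by move=> a; rewrite HZ; exists a.
(* [hor'] and [hor] collect the derivatives of the coefficients. They may differ, but each only
   weights the frame. *)
pose hor' := fun i => Hor B H (F p) (X' (F p)) (g' i) - Hor B H (F p) (Y' (F p)) (f' i).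
pose hor := fun i => Hor B H p (X p) (g i) - Hor B H p (Y p) (f i).
have LE' : lie_bracket (fun y => Hor B H y (X' y)) (fun y => Hor B H y (Y' y)) (F p) =
    push F p (lie_bracket (fun y => Hor B H y (X y)) (fun y => Hor B H y (Y y)) p) +
    push F p (\sum_i hor' i *: Z i p - \sum_i hor i *: Z i p).
  rewrite (lie_bracket_lincomb sZ' sf' sg' fE' gE').
  rewrite (lie_bracket_lincomb sZ sf sg fE gE) pE pushD pushB.
  rewrite [RHS]addrC addrA subrK; congr (_ + _).
  rewrite push_sum; apply: eq_bigr => i _; rewrite pushZ ff; congr (_ *: _).
  rewrite push_sum; apply: eq_bigr => j _; rewrite pushZ gg; congr (_ *: _).
  exact: lie_bracket_push_field.
rewrite LE'; apply: Ver_push_bracket; try exact: smooth_Hor.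
rewrite (nbhs_singleton HF); eexists; last reflexivity.
by apply: subbundleB.
Qed.

(** Each side picks its own extensions by [xget]. [tangent_extension] ensures that some exist, and
    [Ver_bracket_transport] accepts any choice on either side. Verticality is recorded for the later
    use of [push_division_Ad]. *)
Lemma ehresmann_curvature_transport u v u' v' : tangent p u -> tangent p v ->
  tangent (F p) u' -> tangent (F p) v' ->
  Hor B H (F p) u' = push F p (Hor B H p u) ->
  Hor B H (F p) v' = push F p (Hor B H p v) ->
  vertical B p (ehresmann_curvature B H p u v) /\
  ehresmann_curvature B H (F p) u' v' =
  push F p (ehresmann_curvature B H p u v).
Proof.
move=> tu tv tu' tv' uE vE.
have ext q a b : tangent q a -> tangent q b ->
    exists w U (X Y : P -> tvec P),
    [/\ open_nbhs q U, smooth_vector_field U X, smooth_vector_field U Y,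
        X q = a /\ Y q = b &
        w = - Ver B H q (lie_bracket (fun z => Hor B H z (X z))
                                     (fun z => Hor B H z (Y z)) q)].
  move=> /tangent_extension[U [X [[oU Uq] sX Xq]]] /tangent_extension[V [Y [[oV Vq] sY Yq]]].
  exists (- Ver B H q (lie_bracket (fun z => Hor B H z (X z))
                                   (fun z => Hor B H z (Y z)) q)).
  exists (U `&` V), X, Y; split=> //.
  - by split; [exact: openI|].
  - by move=> z [/sX].
  - by move=> z [_ /sY].
rewrite /ehresmann_curvature.
case: xgetP => [w _|none]; last first.
  by have [w wP] := ext _ _ _ tu tv; case: (none w).
case=> U [X [Y [nU sX sY [XE YE] ->]]].
case: xgetP => [w' _|none']; last first.
  by have [w' w'P] := ext _ _ _ tu' tv'; case: (none' w').
case=> U' [X' [Y' [nU' sX' sY' [X'E Y'E] ->]]].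
split; first by apply: verticalN; exact: Ver_vertical.
rewrite (Ver_bracket_transport (smooth_vector_field_at nU sX)
  (smooth_vector_field_at nU sY) (smooth_vector_field_at nU' sX')
  (smooth_vector_field_at nU' sY')) ?X'E ?Y'E ?XE ?YE //.
by rewrite -scaleN1r -pushZ scaleN1r.
Qed.

End transport.

End horizontal.

(** * Principal bundles and gauge transformations *)

Section subset_smooth.
Context {R : realType}.
Implicit Types M N L : manifold R.

(** As long as [c] stays in [D], the local extension supplied by [smooth_on] may replace [f] along
    [c]. *)
Lemma smooth_on_comp M N L (D : set N) (f : N -> L) (c : M -> N) x :
  smooth_on D f -> smooth_at c x -> (\near x, D (c x)) ->
  smooth_at (fun y => f (c y)) x.
Proof.
move=> sf sc Dc; have [h [sh hf]] := sf _ (nbhs_singleton Dc).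
apply: (@smooth_at_ext _ _ _ (h \o c)); last exact: smooth_at_comp.
have hfc : \forall y \near x, D (c y) -> h (c y) = f (c y).
  exact: (smooth_at_continuous sc hf).
by near=> y; rewrite /=; near: y; apply: filterS (filterI Dc hfc) => y [? /(_ _)->].
Unshelve. all: by end_near. Qed.

End subset_smooth.

(** * The division map and vertical vectors *)

Section bundle.
Context {R : realType} {G : lie_groupoid R} {P M : manifold R}.
Variable B : principal_bundle G P M.

Let smooth_proj : smooth (bproj B). Proof. by have [] := proj_bundle B. Qed.

Lemma smooth_at_act (N : manifold R) (f : N -> P) (g : N -> arrows G) x :
  smooth_at f x -> smooth_at g x ->
  (\near x, moment B (f x) = gsrc (g x)) ->
  smooth_at (fun y => act B (f y) (g y)) x.
Proof.
move=> sf sg fg.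
exact: (@smooth_on_comp _ N (prod_manifold P (arrows G)) P _
  (fun pg => act B pg.1 pg.2) (fun y => (f y, g y)) x (@act_smooth _ _ _ _ B)
  (smooth_at_pair sf sg) fg).
Qed.

Lemma smooth_at_gmul (N : manifold R) (f g : N -> arrows G) x :
  smooth_at f x -> smooth_at g x ->
  (\near x, gtgt (f x) = gsrc (g x)) ->
  smooth_at (fun y => gmul (f y) (g y)) x.
Proof.
move=> sf sg fg.
exact: (@smooth_on_comp _ N (prod_manifold (arrows G) (arrows G)) (arrows G) _
  (fun gh => gmul gh.1 gh.2) (fun y => (f y, g y)) x (@gmul_smooth _ G)
  (smooth_at_pair sf sg) fg).
Qed.

Lemma actVK p g : moment B p = gsrc g -> act B (act B p g) (ginv g) = p.
Proof. by move=> pg; rewrite -actM // ?gsrc_inv // gmulV -pg act1. Qed.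

Lemma actKV p g : moment B p = gtgt g -> act B (act B p (ginv g)) g = p.
Proof. by move=> pg; rewrite -actM ?gsrc_inv ?gtgt_inv // gmulVl -pg act1. Qed.

Lemma act_inj p g h : moment B p = gsrc g -> moment B p = gsrc h ->
  act B p g = act B p h -> g = h.
Proof.
have [I [_ _ IK _]] := act_principal B => pg ph gh.
have [_ /= Ig] := IK (p, g) pg; have [_ /= Ih] := IK (p, h) ph.
by move: Ig; rewrite gh Ih => -[].
Qed.

Lemma divisionP p q : bproj B p = bproj B q ->
  moment B p = gsrc (division B p q) /\ act B p (division B p q) = q.
Proof.
have [I [_ _ _ KI]] := act_principal B => pq.
have [/= Ipq [I1 I2]] := KI (p, q) pq; rewrite I1 in Ipq I2.
by rewrite /division; case: xgetP => [g -> //|/(_ (I (p, q)).2)[]].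
Qed.

Lemma division_act p g : moment B p = gsrc g -> division B p (act B p g) = g.
Proof.
move=> pg; have [h1 h2] := @divisionP p (act B p g) (esym (proj_act pg)).
exact: act_inj h1 pg h2.
Qed.

Lemma division_self p : division B p p = gunit G (moment B p).
Proof. by rewrite -{2}(act1 B p) division_act ?gsrc_unit. Qed.

(** Division by [p] is the second component of the inverse of [(p, g) |-> (p, pg)], restricted to
    pairs with first entry [p]; an extension of that inverse restricts to one of [division B p]. *)
Lemma smooth_on_division p :
  smooth_on [set q | bproj B p = bproj B q] (division B p).
Proof.
move=> q pq; have [I [_ sI _ KI]] := act_principal B.
have [h [sh hI]] := sI (p, q) pq.
have sp : smooth_at (N := prod_manifold P P) (fun r => (p, r)) q.
  by apply: smooth_at_pair; [exact: smooth_at_cst|exact: smooth_at_id].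
exists (fun r => (h (p, r)).2); split.
  apply: (@smooth_at_comp _ _ (prod_manifold P (arrows G)) _ (fun r => h (p, r)) snd).
    exact: (smooth_at_comp sp sh).
  exact: smooth_at_snd.
have nI : \forall r \near q, bproj B p = bproj B r -> h (p, r) = I (p, r).
  exact: (smooth_at_continuous sp hI).
apply: filterS nI => r hr pr.
rewrite hr //; have [/= Ipr [I1 I2]] := KI (p, r) pr.
by rewrite I1 in Ipr I2; rewrite -[in RHS]I2 division_act.
Qed.

(** [push_division] uses an arbitrarily chosen local extension. Along a curve in the fibre the
    extension agrees with the division map, so the choice disappears. *)
Lemma smooth_division_curve p (c : R -> P) : smooth_curve_at c 0 -> c 0 = p ->
  (\forall s \near 0, bproj B p = bproj B (c s)) ->
  smooth_curve_at (division B p \o c) 0 /\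
  push_division B p (velocity c 0) = velocity (division B p \o c) 0.
Proof.
move=> sc cp fib; split.
  exact: (smooth_on_comp (@smooth_on_division p) sc).
rewrite /push_division /push_on.
have [e' e'P] := @smooth_on_division p p erefl.
set e := xget _ _; have [se ediv] : local_extension [set q | bproj B p = bproj B q]
  (division B p) p e by exact: xgetPex (ex_intro _ e' e'P).
rewrite push_velocity //; apply: velocity_ext.
have ec := near_curve sc cp ediv.
by near=> s; rewrite /=; near: s; apply: filterS (filterI fib ec) => s [? /(_ _)->].
Unshelve. all: by end_near. Qed.

(** The curve defining [v] may leave the fibre. In a local trivialisation its base component is
    frozen at [bproj B p]; by [velocity_pair] this removes a term that depends only on the image of
    [v] under the projection, which is 0. *)
Lemma vertical_curve p v : vertical B p v ->
  exists c, [/\ smooth_curve_at c 0, c 0 = p,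
    \forall s \near 0, bproj B p = bproj B (c s) & v = velocity c 0].
Proof.
move=> [[c [sc cp ->]] v0].
have [_ /(_ (bproj B p))[F [U [Phi [oU [Psi [sPhi sPsi K KV]] Phi1]]]]] := proj_bundle B.
have [oU' Up] := oU.
have sPhip : smooth_at (N := prod_manifold M F) Phi p.
  apply: smooth_at_on_open sPhi => //.
  by apply: open_comp => // y _; exact: (smooth_at_continuous (smooth_proj y)).
have sPhi2 : smooth_at (fun q => (Phi q).2) p.
  exact: (@smooth_at_comp _ P (prod_manifold M F) F Phi snd p sPhip (smooth_at_snd _)).
have [PhiU PhiK] := K p Up.
have Phi1p := Phi1 p Up.
have PhiE : Phi p = (bproj B p, (Phi p).2) by rewrite -Phi1p -surjective_pairing.
have sPsip : smooth_at (M := prod_manifold M F) Psi (bproj B p, (Phi p).2).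
  apply: (smooth_at_on_open _ _ sPsi) => //=.
  apply: (@open_comp _ _ (fst : M * F -> M)) => // y _.
  exact: (smooth_at_continuous (smooth_at_fst (M := M) (N := F) y)).
have sc2 : smooth_curve_at (fun s => (Phi (c s)).2) 0.
  by apply: (@smooth_at_comp _ (line R) P F c (fun q => (Phi q).2)); rewrite ?cp.
have sc1 : smooth_curve_at (fun s => bproj B (c s)) 0.
  by apply: (@smooth_at_comp _ (line R) P M c (bproj B)); rewrite ?cp.
have PsiE y f : U y -> bproj B (Psi (y, f)) = y.
  move=> Uy; have [Uz zE] := KV (y, f) Uy.
  by rewrite -(Phi1 _ Uz) zE.
exists (fun s => Psi (bproj B p, (Phi (c s)).2)); split.
- apply: (@smooth_at_comp _ (line R) (prod_manifold M F) P
    (fun s => (bproj B p, (Phi (c s)).2)) Psi); last by rewrite /= cp.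
  by apply: smooth_at_pair => //; exact: smooth_at_cst.
- by rewrite cp -PhiE.
- by near=> s; rewrite PsiE.
- transitivity (velocity (fun s => Psi (bproj B (c s), (Phi (c s)).2)) 0).
    apply: velocity_ext.
    have : \forall s \near 0, U (bproj B (c s)).
      exact: (near_curve sc1 (congr1 (bproj B) cp) (open_nbhs_nbhs oU)).
    apply: filterS => s Us; have [_ {1}<-] := K (c s) Us.
    by rewrite -[in RHS](Phi1 _ Us) -surjective_pairing.
  rewrite (@velocity_pair _ M F P Psi) ?cp // -[RHS]add0r; congr (_ + _).
  (* The partial velocity in the base direction is the image of [push (bproj B) p v], hence 0. *)
  have -> : velocity (fun s => Psi (bproj B (c s), (Phi p).2)) 0 =
      push (fun y => Psi (y, (Phi p).2)) (bproj B p) (velocity (bproj B \o c) 0).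
    rewrite push_velocity //= ?cp //.
    apply: (@smooth_at_comp _ M (prod_manifold M F) P (fun y => (y, (Phi p).2)) Psi) => //.
    by apply: smooth_at_pair; [exact: smooth_at_id|exact: smooth_at_cst].
  by rewrite -(push_velocity cp (smooth_proj p)) v0 push0.
Unshelve. all: by end_near. Qed.

Lemma velocity_vertical p (c : R -> P) : smooth_curve_at c 0 -> c 0 = p ->
  (\forall s \near 0, bproj B p = bproj B (c s)) -> vertical B p (velocity c 0).
Proof.
move=> sc cp fib; split; first exact: tangent_velocity.
rewrite (push_velocity cp (smooth_proj p)) -(velocity_cst (bproj B p) 0).
by apply: velocity_ext; apply: filterS fib => s ->.
Qed.

(** Along a curve in the fibre through [p], division by [p] starts at a unit and has constant source
    [moment B p]. *)
Lemma push_division_algebroid p v : vertical B p v ->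
  lie_algebroid (moment B p) (push_division B p v).
Proof.
move=> /vertical_curve[c [sc cp fib ->]].
have [sd ->] := smooth_division_curve sc cp fib.
have d0 : (division B p \o c) 0 = gunit G (moment B p) by rewrite /= cp division_self.
split; first exact: tangent_velocity.
rewrite push_velocity //; last by have [+ _] := @gsrc_submersion _ G; apply.
rewrite -(velocity_cst (moment B p) 0); apply: velocity_ext.
by apply: filterS fib => s /divisionP[].
Qed.

Lemma push_divisionD p v w :
  push_division B p (v + w) = push_division B p v + push_division B p w.
Proof. exact: pushD. Qed.

Definition bisection_act (b : objects G -> arrows G) (q : P) : P :=
  act B q (b (moment B q)).

(** * The transformation of the total space given by one bisection *)

Section bisection_act.
Variables (U : set (objects G)) (b : objects G -> arrows G).
Hypothesis bU : bisection U b.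

Let F := bisection_act b.
Let oU : open U. Proof. by case: bU. Qed.
Let gsrc_b x : U x -> gsrc (b x) = x. Proof. by case: bU => _ _ + _; exact. Qed.
Let smooth_b x : U x -> smooth_at b x.
Proof. by case: bU => _ sb _ _ Ux; exact: smooth_at_on_open sb. Qed.

Lemma near_moment (V : set (objects G)) q : open V -> V (moment B q) ->
  \near q, V (moment B q).
Proof.
by move=> oV Vq; apply: (smooth_at_continuous (moment_smooth B q)); exact: open_nbhs_nbhs.
Qed.

Lemma smooth_bisection_act q : U (moment B q) -> smooth_at F q.
Proof.
move=> Uq; apply: smooth_at_act; first exact: smooth_at_id.
  by apply: (smooth_at_comp (moment_smooth B q)); exact: smooth_b.
by apply: filterS (near_moment oU Uq) => y /gsrc_b ->.
Qed.

Lemma proj_bisection_act q : U (moment B q) -> bproj B (F q) = bproj B q.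
Proof. by move=> Uq; rewrite /F /bisection_act proj_act // gsrc_b. Qed.

(** The moment of [F y] is [gtgt (b (moment B y))], and [be] inverts [gtgt \o b]. So [moment B y]
    can be read off from [F y], and acting with the inverse of the corresponding arrow of [b] undoes
    [F]. *)
Lemma bisection_act_inverse p : U (moment B p) ->
  exists F' : P -> P, [/\ smooth_at F' (F p),
    \near p, F' (F p) = p & \forall z \near F p, F (F' z) = z].
Proof.
case: bU => _ _ _ [V oV [be [sbe sbe' bK bVK]]] Up.
have mF y : U (moment B y) -> moment B (F y) = gtgt (b (moment B y)).
  by move=> Uy; rewrite /F /bisection_act moment_act // gsrc_b.
have VF y : U (moment B y) -> V (moment B (F y)).
  by move=> Uy; rewrite mF //; have [] := bK _ Uy.
exists (fun z => act B z (ginv (b (be (moment B z))))); split.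
- apply: smooth_at_act; first exact: smooth_at_id.
    apply: (@smooth_at_comp _ P (arrows G) (arrows G) (fun z => b (be (moment B z))) (@ginv _ G)).
      apply: (@smooth_at_comp _ P (objects G) (arrows G) (fun z => be (moment B z)) b).
        apply: (smooth_at_comp (moment_smooth B (F p))).
        by apply: smooth_at_on_open sbe' => //; exact: VF.
      by apply: smooth_b; have [] := bVK _ (VF p Up).
    exact: ginv_smooth.
  have := near_moment oV (VF p Up); apply: filterS => z Vz.
  by rewrite gsrc_inv; have [_ /= ->] := bVK _ Vz.
- apply: filterS (near_moment oU Up) => y Uy.
  rewrite mF //; have [_ /= ->] := bK _ Uy.
  by rewrite actVK // gsrc_b.
- apply: filterS (near_moment oV (VF p Up)) => z Vz.
  have [Uz /= zE] := bVK _ Vz.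
  rewrite /F /bisection_act moment_act ?gsrc_inv // gtgt_inv gsrc_b //.
  by rewrite actKV.
Qed.

(** Along a curve [c] with velocity [v], the map [F] moves both the point and the arrow
    [b (moment B (c s))]. With the arrow fixed one gets right translation; with the point fixed one
    gets an image of [push (moment B) q v], which vanishes on [H]. *)
Lemma push_act_bisection (H : P -> set (tvec P)) q v :
  subbundle H -> moerdijk_mrcun B H -> U (moment B q) -> H q v ->
  push_act B (b (moment B q)) q v = push F q v.
Proof.
move=> sH mmH Uq Hv; have tv := subbundle_tangent sH Hv.
have v0 := mmH q v Hv.
case: tv v0 => c [sc cq ->] v0.
rewrite /push_act /push_on.
set g := b (moment B q).
have qg : [set qh : prod_manifold P (arrows G) | moment B qh.1 = gsrc qh.2] (q, g).
  by rewrite /= gsrc_b.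
have [e' e'P] := @act_smooth _ _ _ _ B _ qg.
set e := xget _ _.
have [se eact] : local_extension (M := prod_manifold P (arrows G))
    [set qh | moment B qh.1 = gsrc qh.2] (fun qh => act B qh.1 qh.2) (q, g) e.
  exact: xgetPex (ex_intro _ e' e'P).
have sm : smooth_curve_at (moment B \o c) 0.
  by apply: (@smooth_at_comp _ (line R) P _ c (moment B)); rewrite ?cq //; exact: moment_smooth.
have sbm : smooth_curve_at (fun s => b (moment B (c s))) 0.
  apply: (@smooth_at_comp _ (line R) (objects G) (arrows G) (moment B \o c) b) => //=.
  by rewrite cq; exact: smooth_b.
have sq1 : smooth_at (N := prod_manifold P (arrows G)) (fun r => (r, g)) q.
  by apply: smooth_at_pair; [exact: smooth_at_id|exact: smooth_at_cst].
rewrite (push_velocity cq sq1).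
rewrite (@push_velocity _ (prod_manifold P (arrows G)) P e); last 2 first.
- by rewrite /= cq.
- by [].
rewrite (push_velocity cq (smooth_bisection_act Uq)).
(* The pairs [(c s, b (moment B (c s)))] lie in the fibre product, where [e] is the action. After
   the splitting, the pairs [(c s, g)] may leave it, so the partial velocities are those of the
   extension [e]. *)
transitivity (velocity (fun s => e (c s, b (moment B (c s)))) 0); last first.
  apply: velocity_ext.
  have n1 : \forall s \near 0, U (moment B (c s)).
    exact: (near_curve sc cq (near_moment oU Uq)).
  have sp : smooth_curve_at (M := prod_manifold P (arrows G))
      (fun s => (c s, b (moment B (c s)))) 0 by exact: smooth_at_pair.
  have n2 := near_curve sp (_ : (c 0, b (moment B (c 0))) = (q, g)) eact.
  rewrite cq in n2; have {}n2 := n2 erefl.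
  near=> s; rewrite /= /F /bisection_act.
  have /= -> // : [set qh : prod_manifold P (arrows G) | moment B qh.1 = gsrc qh.2]
    (c s, b (moment B (c s))) ->
    e (c s, b (moment B (c s))) = act B (c s) (b (moment B (c s))) by near: s.
  by rewrite gsrc_b //; near: s.
rewrite (@velocity_pair _ P (arrows G) P e) // ?cq //.
rewrite -[LHS]addr0; congr (_ + _).
have -> : velocity (fun s => e (q, b (moment B (c s)))) 0 =
    push (fun y => e (q, b y)) (moment B q) (velocity (moment B \o c) 0).
  rewrite push_velocity //= ?cq //.
  apply: (@smooth_at_comp _ (objects G) (prod_manifold P (arrows G)) P
    (fun y => (q, b y)) e) => //.
  by apply: smooth_at_pair; [exact: smooth_at_cst|exact: smooth_b].
by rewrite -(push_velocity cq (moment_smooth B q)) v0 push0.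
Unshelve. all: by end_near. Qed.

Lemma principal_bisection_act (H : P -> set (tvec P)) p :
  principal_connection B H -> U (moment B p) ->
  \near p, H (F p) = push F p @` H p.
Proof.
move=> [[sH _ _] mmH pH] Up; apply: filterS (near_moment oU Up) => y Uy.
rewrite /F /bisection_act pH ?gsrc_b //.
by apply: eq_imagel => v Hv; exact: push_act_bisection.
Qed.

Lemma smooth_conj_bisection x : U x -> smooth_at (conj_bisection b) (gunit G x).
Proof.
move=> Ux.
have ss : smooth (@gsrc R G) by have [] := @gsrc_submersion _ G.
have st : smooth (@gtgt R G) by have [] := @gtgt_submersion _ G.
have nU : \near x, U x by exact: open_nbhs_nbhs.
have ns : \forall k \near gunit G x, U (gsrc k).
  by apply: (smooth_at_continuous (ss _)); rewrite /= gsrc_unit.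
have nt : \forall k \near gunit G x, U (gtgt k).
  by apply: (smooth_at_continuous (st _)); rewrite /= gtgt_unit.
apply: smooth_at_gmul.
- apply: (@smooth_at_comp _ _ (arrows G) _ (fun k => b (gsrc k)) (@ginv _ G)); last exact: ginv_smooth.
  by apply: smooth_at_comp; rewrite // gsrc_unit; exact: smooth_b.
- apply: smooth_at_gmul; first exact: smooth_at_id.
    by apply: smooth_at_comp; rewrite // gtgt_unit; exact: smooth_b.
  by apply: filterS nt => k Uk; rewrite gsrc_b.
- near=> k; have Us : U (gsrc k) by near: k.
  have Ut : U (gtgt k) by near: k.
  by rewrite gtgt_inv gsrc_b // gsrc_mul // gsrc_b.
Unshelve. all: by end_near. Qed.

(** If [q = p k], then [F q = p k b(t k)]; inserting [b(s k) b(s k)^-1] after [p] turns this into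
    [F p] acted on by the conjugate of [k]. *)
Lemma division_bisection_act p q : U (moment B p) -> U (moment B q) ->
  bproj B p = bproj B q ->
  division B (F p) (F q) = conj_bisection b (division B p q).
Proof.
move=> Up Uq pq; have [pk kq] := divisionP pq; set k := division B p q in pk kq *.
have tk : gtgt k = moment B q by rewrite -kq moment_act.
have Ut : U (gtgt k) by rewrite tk.
have kb : gtgt k = gsrc (b (gtgt k)) by rewrite gsrc_b.
have pb : moment B p = gsrc (b (moment B p)) by rewrite gsrc_b.
have bk : gtgt (ginv (b (moment B p))) = gsrc (gmul k (b (gtgt k))).
  by rewrite gtgt_inv gsrc_mul // -pb.
have mF : moment B (F p) = gsrc (ginv (b (moment B p))).
  by rewrite gsrc_inv /F /bisection_act moment_act.
have -> : F q = act B (F p) (conj_bisection b k).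
  rewrite /conj_bisection -pk actM // {2}/F /bisection_act actVK //.
  by rewrite actM // kq tk.
by rewrite division_act // /conj_bisection -pk gsrc_mul.
Qed.

(** Differentiate [division_bisection_act] along a curve in the fibre, at the time when the quotient
    is a unit. *)
Lemma push_division_Ad p v : U (moment B p) -> vertical B p v ->
  push_division B (F p) (push F p v) = Ad_inv b (moment B p) (push_division B p v).
Proof.
move=> Up /vertical_curve[c [sc cp fib ->]].
have nU : \forall s \near 0, U (moment B (c s)).
  exact: (near_curve sc cp (near_moment oU Up)).
have [sd ->] := smooth_division_curve sc cp fib.
have sF := smooth_bisection_act Up.
rewrite (push_velocity cp sF).
have sFc : smooth_curve_at (F \o c) 0.
  by apply: (@smooth_at_comp _ (line R) P P) => //; rewrite cp.
have fibF : \forall s \near 0, bproj B (F p) = bproj B ((F \o c) s).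
  by near=> s; rewrite /= !proj_bisection_act //; near: s.
have [_ ->] := smooth_division_curve sFc (congr1 F cp) fibF.
rewrite /Ad_inv push_velocity; last 2 first.
- by rewrite /= cp division_self.
- exact: smooth_conj_bisection.
apply: velocity_ext; near=> s; rewrite /= division_bisection_act //; by near: s.
Unshelve. all: by end_near. Qed.

End bisection_act.

(** * The velocity of the transformed section *)

Section gauge.
Variables (H : P -> set (tvec P)) (sigma : M -> P).
Variables (D : set (prod_manifold M (objects G))) (gam : M -> objects G -> arrows G).
Hypotheses (hH : principal_connection B H) (sigma_smooth : smooth sigma).
Hypotheses (hgam : smooth_bisection_map D gam).
Hypothesis hD : forall m, D (m, moment B (sigma m)).

Let bis m : bisection [set x | D (m, x)] (gam m). Proof. by case: hgam. Qed.
Let oD : open D. Proof. by case: hgam. Qed.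

(** The point acted on and the index of the bisection are made independent, to prepare for
    [velocity_pair]. With the index fixed the map is [bisection_act (gam m)]; with the point fixed
    it moves inside a fibre. *)
Lemma smooth_gauge_section_pair m :
  smooth_at (M := prod_manifold P M)
    (fun r => act B r.1 (gam r.2 (moment B r.1))) (sigma m, m).
Proof.
pose PM := prod_manifold P M; pose MG := prod_manifold M (objects G).
have s1 : smooth_at (M := PM) (N := P) fst (sigma m, m) by exact: smooth_at_fst.
have s2 : smooth_at (M := PM) (N := M) snd (sigma m, m) by exact: smooth_at_snd.
have s3 : smooth_at (M := PM) (N := MG) (fun r => (r.2, moment B r.1)) (sigma m, m).
  apply: smooth_at_pair => //.
  exact: (@smooth_at_comp _ PM P (objects G) fst _ _ s1 (moment_smooth B _)).
apply: (@smooth_at_act PM) => //.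
  apply: (@smooth_at_comp _ PM MG (arrows G) _ (fun mx => gam mx.1 mx.2) _ s3).
  by case: hgam => _ sgam _; apply: smooth_at_on_open sgam.
have : \forall r \near ((sigma m, m) : PM), D (r.2, moment B r.1).
  apply: (smooth_at_continuous s3); apply: open_nbhs_nbhs.
  by split; [exact: oD|exact: hD].
by apply: filterS => r Dr; case: (bis r.2) => _ _ /(_ _ Dr) ->.
Qed.

Lemma smooth_gauge_section m : smooth_at (gauge_section B sigma gam) m.
Proof.
have sp : smooth_at (N := prod_manifold P M) (fun m' => (sigma m', m')) m.
  by apply: smooth_at_pair; [exact: sigma_smooth|exact: smooth_at_id].
exact: (smooth_at_comp sp (smooth_gauge_section_pair m)).
Qed.

Lemma push_gauge_section (x : R -> M) m : smooth_curve_at x 0 -> x 0 = m ->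
  exists u, [/\ vertical B (gauge_section B sigma gam m) u,
    push_division B (gauge_section B sigma gam m) u = log_derivative B sigma gam x &
    push (gauge_section B sigma gam) m (velocity x 0) =
      push (bisection_act (gam m)) (sigma m) (push sigma m (velocity x 0)) + u].
Proof.
move=> sx xm; set q := gauge_section _ _ _ _; set y := moment B (sigma m).
have Dy : D (m, y) by exact: hD.
have gy : y = gsrc (gam m y) by case: (bis m) => _ _ /(_ _ Dy).
have sxs : smooth_curve_at (sigma \o x) 0.
  by apply: (@smooth_at_comp _ (line R) M P) => //; exact: sigma_smooth.
have sg : smooth_at (fun m' => gam m' y) m.
  apply: (@smooth_at_comp _ M (prod_manifold M (objects G)) (arrows G)
    (fun m' => (m', y)) (fun mx => gam mx.1 mx.2)).
    by apply: smooth_at_pair; [exact: smooth_at_id|exact: smooth_at_cst].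
  by case: hgam => _ sgam _; apply: smooth_at_on_open sgam.
have nD : \near m, D (m, y).
  have sp : smooth_at (N := prod_manifold M (objects G)) (fun m' => (m', y)) m.
    by apply: smooth_at_pair; [exact: smooth_at_id|exact: smooth_at_cst].
  by apply: (smooth_at_continuous sp); exact: open_nbhs_nbhs.
have ny : \near m, y = gsrc (gam m y).
  by apply: filterS nD => m' Dm; case: (bis m') => _ _ /(_ _ Dm).
have nyx := near_curve sx xm ny.
pose c s := act B (sigma m) (gam (x s) y).
have sgx : smooth_curve_at (fun s => gam (x s) y) 0.
  by apply: (@smooth_at_comp _ (line R) M (arrows G) x (fun m' => gam m' y)) => //; rewrite xm.
have sc : smooth_curve_at c 0.
  by apply: (@smooth_at_act (line R)) => //; exact: smooth_at_cst.
have cq : c 0 = q by rewrite /c xm.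
have fib : \forall s \near 0, bproj B q = bproj B (c s).
  apply: filterS nyx => s ys.
  by rewrite /q /c /gauge_section !proj_act.
exists (velocity c 0); split.
- exact: velocity_vertical.
- have [_ ->] := smooth_division_curve sc cq fib.
  rewrite /log_derivative xm; apply: velocity_ext.
  apply: filterS nyx => s ys /=.
  have tg : gtgt (ginv (gam m y)) = gsrc (gam (x s) y) by rewrite gtgt_inv -gy.
  have mq : moment B q = gsrc (ginv (gam m y)).
    by rewrite gsrc_inv /q /gauge_section moment_act.
  (* Rewritten from the base point [q], the curve [c] has as quotients exactly the arrows
     differentiated in [log_derivative]. *)
  have -> : c s = act B q (gmul (ginv (gam m y)) (gam (x s) y)).
    by rewrite actM // /q /gauge_section actVK.
  by rewrite division_act // gsrc_mul.
- rewrite (push_velocity xm (smooth_gauge_section m)).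
  rewrite (push_velocity xm (sigma_smooth m)) push_velocity; last 2 first.
  + by rewrite /= xm.
  + exact: smooth_bisection_act (bis m) _ Dy.
  have := @velocity_pair _ P M P (fun r => act B r.1 (gam r.2 (moment B r.1)))
    (sigma \o x) x 0 sxs sx.
  rewrite /= xm => -> //; exact: smooth_gauge_section_pair.
Qed.

End gauge.

End bundle.

Theorem theorem3p6 (R : realType) (G : lie_groupoid R) (P M : manifold R)
    (B : principal_bundle G P M) (H : P -> set (tvec P))
    (hH : principal_connection B H)
    (sigma : M -> P) (sigma_smooth : smooth sigma)
    (sigma_section : forall m, bproj B (sigma m) = m)
    (D : set (prod_manifold M (objects G)))
    (gam : M -> objects G -> arrows G)
    (hgam : smooth_bisection_map D gam)
    (hD : forall m, D (m, moment B (sigma m))) :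
  let sigma_gam := gauge_section B sigma gam in
  let Ad (m : M) := Ad_inv (gam m) (moment B (sigma m)) in
  let A (m : M) := lie_algebroid (gtgt (gam m (moment B (sigma m)))) in
  (forall (m : M) (X : tvec M), tangent m X ->
    forall x : R -> M, smooth_curve_at x 0 -> x 0 = m -> velocity x 0 = X ->
    [/\ A m (local_connection_form B H sigma_gam m X),
        A m (Ad m (local_connection_form B H sigma m X)),
        A m (log_derivative B sigma gam x) &
        local_connection_form B H sigma_gam m X =
          Ad m (local_connection_form B H sigma m X)
          + log_derivative B sigma gam x]) /\
  (forall (m : M) (X Y : tvec M), tangent m X -> tangent m Y ->
    [/\ A m (local_curvature B H sigma_gam m X Y),
        A m (Ad m (local_curvature B H sigma m X Y)) &
        local_curvature B H sigma_gam m X Y =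
          Ad m (local_curvature B H sigma m X Y)]).
Proof.
move=> sigma_gam Ad A; case: (hH) => hd mm _.
have bis m : bisection [set x | D (m, x)] (gam m) by case: hgam.
pose F m := bisection_act B (gam m).
have sF m : smooth_at (F m) (sigma m) := smooth_bisection_act (bis m) (hD m).
have HF m := principal_bisection_act (bis m) hH (hD m).
have projF m : \forall y \near sigma m, bproj B (F m y) = bproj B y.
  have oDm : open [set x | D (m, x)] by case: (bis m).
  by apply: filterS (near_moment oDm (hD m)) => y; exact: (proj_bisection_act (bis m)).
(* The moment of [sigma_gam m] is the target of [gam m (moment B (sigma m))], so division by
   [sigma_gam m] lands in the fibre named in the theorem. *)
have AE m v : vertical B (sigma_gam m) v -> A m (push_division B (sigma_gam m) v).
  move=> /push_division_algebroid; rewrite /A {1}/sigma_gam /gauge_section.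
  by rewrite moment_act //; case: (bis m) => _ _ /(_ _ (hD m)) ->.
have tsig m X : tangent m X -> tangent (sigma m) (push sigma m X).
  exact: tangent_push.
have tgam m X : tangent m X -> tangent (sigma_gam m) (push sigma_gam m X).
  by apply: tangent_push; apply: (smooth_gauge_section sigma_smooth hgam hD).
(* Both formulas come from this decomposition: the vertical part gives the connection form, the
   horizontal part the curvature. *)
have VerE m x : smooth_curve_at x 0 -> x 0 = m ->
    let s := push sigma m (velocity x 0) in
    let s' := push sigma_gam m (velocity x 0) in
    exists u, [/\ vertical B (sigma_gam m) u,
      push_division B (sigma_gam m) u = log_derivative B sigma gam x,
      Ver B H (sigma_gam m) s' = push (F m) (sigma m) (Ver B H (sigma m) s) + u &
      Hor B H (sigma_gam m) s' = push (F m) (sigma m) (Hor B H (sigma m) s)].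
  move=> sx xm s s'.
  have [u [vu uE s'E]] := push_gauge_section sigma_smooth hgam hD sx xm.
  have [vs hs] := VerP hd (tsig m _ (tangent_velocity sx xm)).
  have s'VE : Ver B H (sigma_gam m) s' = push (F m) (sigma m) (Ver B H (sigma m) s) + u.
    apply: Ver_eq => //.
      by apply: verticalD => //; exact: (vertical_push (sF m) (projF m)).
    (* What remains after removing the claimed vertical part is the image under [F m] of a
       horizontal vector, hence horizontal. *)
    rewrite /s' s'E opprD addrACA subrr addr0 -pushB.
    rewrite (nbhs_singleton (HF m) : H (sigma_gam m) = _).
    by exists (Hor B H (sigma m) s).
  exists u; split=> //; rewrite /Hor s'VE {1}/s' s'E opprD addrACA subrr addr0.
  by rewrite -pushB.
split=> [m _ _ x sx xm <-|m X Y tX tY].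
  have [u [vu uE VE _]] := VerE m x sx xm.
  have vV := Ver_vertical B H (sigma m) (push sigma m (velocity x 0)).
  have vFV := vertical_push (sF m) (projF m) vV.
  have AdE := push_division_Ad (bis m) (hD m) vV.
  rewrite /local_connection_form /connection_form VE push_divisionD.
  split.
  - by rewrite -push_divisionD; apply: AE; exact: verticalD.
  - by rewrite /Ad -AdE; exact: AE.
  - by rewrite -uE; exact: AE.
  - by rewrite uE; congr (_ + _).
have [F' [sF' FK F'K]] := bisection_act_inverse (bis m) (hD m).
have HorE Z : tangent m Z -> Hor B H (sigma_gam m) (push sigma_gam m Z) =
    push (F m) (sigma m) (Hor B H (sigma m) (push sigma m Z)).
  by move=> [x [sx xm ->]]; have [u []] := VerE m x sx xm.
have [vO OE] := ehresmann_curvature_transport hd (sF m) sF' FK F'K (projF m) (HF m)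
  (tsig m X tX) (tsig m Y tY) (tgam m X tX) (tgam m Y tY) (HorE X tX) (HorE Y tY).
have vFO := vertical_push (sF m) (projF m) vO.
have AdE := push_division_Ad (bis m) (hD m) vO.
rewrite /local_curvature /curvature OE.
split.
- exact: AE.
- by rewrite /Ad -AdE; exact: AE.
- exact: AdE.
Qed.
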